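(* Suppose that there is a nonmeager subset of $\mathbb{R}$ of cardinality $\omega_1$ (this holds, e.g., under the continuum hypothesis). Then: (1) There is an equivalent norm on the Hilbert space $\ell_2(\omega_1)$ such that $\ell_2(\omega_1)$ with this norm does not admit an uncountable equilateral set. (2) There is a nonseparable Hilbert generated Banach space $\mathcal{X}$ such that every nonseparable (closed linear) subspace of $\mathcal{X}$ contains a subspace isomorphic to $\ell_2$, and the unit sphere of $\mathcal{X}$ admits neither an uncountable equilateral set nor, for any $\varepsilon>0$, an uncountable $(1+\varepsilon)$-separated set.
   Context: A Banach space $\mathcal{X}$ is Hilbert generated if there is a bounded linear operator from a Hilbert space into $\mathcal{X}$ with dense range. A set $\mathcal{Y}$ in a Banach space is $\delta$-equilateral if $\|y-y'\|=\delta$ for all distinct $y,y'\in\mathcal{Y}$, and equilateral if it is $\delta$-equilateral for some $\delta>0$; it is $\delta$-separated if $\|y-y'\|\geq\delta$ for all distinct $y,y'\in\mathcal{Y}$. $\ell_2(\omega_1)$ is the Hilbert space of square-summable real functions on the first uncountable ordinal $\omega_1$. *)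

(* Defs.v *)
From HB Require Import structures.
From mathcomp Require Import all_boot all_order all_algebra.
From mathcomp Require Import all_classical all_reals.
From mathcomp Require Import topology normedtype esum.
Set Implicit Arguments. Unset Strict Implicit. Unset Printing Implicit Defensive.
Import Order.TTheory GRing.Theory Num.Theory.
Import numFieldNormedType.Exports.
Local Open Scope classical_set_scope.
Local Open Scope ring_scope.

Section Defs.
Variable R : realType.

Definition nowhere_dense (A : set R) : Prop := interior (closure A) = set0.
Definition meager (A : set R) : Prop :=
  exists F : nat -> set R, (forall n, nowhere_dense (F n)) /\ A `<=` \bigcup_n F n.

(* A (a set in T) has cardinality omega_1 iff it carries a strict, total,
   well-founded order whose proper initial segments are all countable,
   and A itself is uncountable (i.e. A has order type omega_1). *)
Definition omega1_order (T : Type) (A : set T) (lt : T -> T -> Prop) : Prop :=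
  [/\ ~ countable A,
      (forall x, A x -> ~ lt x x) /\
      (forall x y z, A x -> A y -> A z -> lt x y -> lt y z -> lt x z),
      (forall x y, A x -> A y -> [\/ lt x y, x = y | lt y x]),
      (forall B : set T, B `<=` A -> B !=set0 ->
          exists2 m, B m & forall b, B b -> ~ lt b m)
    & (forall x, A x -> countable [set y | A y /\ lt y x])].
Definition card_omega1 (T : Type) (A : set T) : Prop :=
  exists lt : T -> T -> Prop, omega1_order A lt.

Definition l2 (I : choiceType) : set (I -> R) :=
  [set f | (\esum_(i in [set: I]) ((f i) ^+ 2)%:E < +oo)%E].
Definition l2norm (I : choiceType) (f : I -> R) : R :=
  Num.sqrt (fine (\esum_(i in [set: I]) ((f i) ^+ 2)%:E)).

Definition equivalent_l2_norm (I : choiceType) (N : (I -> R) -> R) : Prop :=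
  [/\ (forall x, l2 x -> N x = 0 -> x = (fun _ => 0)),
      (forall (a : R) x, l2 x -> N (fun i => a * x i) = `|a| * N x),
      (forall x y, l2 x -> l2 y -> N (fun i => x i + y i) <= N x + N y)
    & exists c C : R, [/\ 0 < c, 0 < C &
        forall x, l2 x -> c * l2norm x <= N x /\ N x <= C * l2norm x]].

Section Banach.
Variable X : normedModType R.

Definition equilateral_for (d : X -> X -> R) (Y : set X) : Prop :=
  exists2 delta : R, 0 < delta & forall y y', Y y -> Y y' -> y <> y' -> d y y' = delta.
Definition equilateral (Y : set X) : Prop :=
  equilateral_for (fun y y' => `|y - y'|) Y.
Definition delta_separated (delta : R) (Y : set X) : Prop :=
  forall y y', Y y -> Y y' -> y <> y' -> delta <= `|y - y'|.
Definition unit_sphere : set X := [set x | `|x| = 1].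

Definition linear_subspace (S : set X) : Prop :=
  S 0 /\ forall (a : R) x y, S x -> S y -> S (a *: x + y).
Definition closed_subspace (S : set X) : Prop := linear_subspace S /\ closed S.

Definition separable_set (S : set X) : Prop :=
  exists2 D : set X, countable D & D `<=` S /\ S `<=` closure D.
Definition separable_space : Prop := separable_set setT.

Definition contains_l2 (S : set X) : Prop :=
  exists T : (nat -> R) -> X,
    [/\ (forall x, l2 x -> S (T x)),
        (forall (a : R) x y, l2 x -> l2 y ->
            T (fun n => a * x n + y n) = a *: T x + T y)
      & exists c C : R, [/\ 0 < c, 0 < C &
          forall x, l2 x -> c * l2norm x <= `|T x| /\ `|T x| <= C * l2norm x]].
End Banach.

Definition hilbert_space (H : completeNormedModType R) : Prop :=
  exists ip : H -> H -> R,
    [/\ (forall x y, ip x y = ip y x),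
        (forall (a : R) x y z, ip (a *: x + y) z = a * ip x z + ip y z)
      & (forall x, ip x x = `|x| ^+ 2)].

Definition bounded_linear (H X : normedModType R) (T : H -> X) : Prop :=
  (forall (a : R) x y, T (a *: x + y) = a *: T x + T y) /\
  exists C : R, forall x, `|T x| <= C * `|x|.

Definition hilbert_generated (X : completeNormedModType R) : Prop :=
  exists (H : completeNormedModType R) (T : H -> X),
    [/\ hilbert_space H, bounded_linear T & closure (range T) = setT].

End Defs.

(* Main.v *)
Require Import Defs.
From HB Require Import structures.
From mathcomp Require Import all_boot all_order all_algebra.
From mathcomp Require Import all_classical all_reals.
From mathcomp Require Import topology normedtype esum.
From mathcomp Require Import ring lra zify.
From mathcomp Require Import sequences ereal.
Import Order.TTheory GRing.Theory Num.Theory.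
Import numFieldNormedType.Exports.
Set Implicit Arguments. Unset Strict Implicit. Unset Printing Implicit Defensive.
Local Open Scope classical_set_scope.
Local Open Scope ring_scope.

(* The graph norm.  For a graph E on I, X_E is the completion of the finitely
   supported functions under ||f||_E, the supremum of the Euclidean norms of
   the restrictions of f to finite cliques of E; the complete graph gives l2(I).

   A generic graph.  A nonmeager set of omega_1 reals provides omega_1 guesses
   such that every sequence of integers is infinitely often guessed correctly.
   Letting each alpha < omega_1 obey countably many guesses, the earliest one
   winning, one gets a graph E on omega_1 in which, for every uncountable
   family of disjoint finite sets, there are members with all cross edges and
   members with no cross edge.

   The geometry.  By a Delta-system argument an uncountable set of vectors is
   close to r + u_t, where r is fixed and the u_t have disjoint finite supports
   and nearly the same norm nu.  If there are no cross edges then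
   ||u_s - u_t||_E <= nu, which excludes (1 + eps)-separation; if all cross
   edges are present then ||u_s - u_t||_E >= sqrt 2 * nu, so no single distance
   is possible.  For the norm ||.||_2 + ||.||_E on l2 the first summand of the
   distance does not depend on the pattern, so the argument still applies.
   In a nonseparable subspace one successively picks almost disjoint vectors
   with norming cliques that are completely joined to each other: they span
   a copy of l2. *)

Lemma filter_all_in (T : Type) (F : set_system T) {FF : Filter F} (J : eqType)
  (s : seq J) (P : J -> set T) : (forall i, F (P i)) ->
  F [set y | {in s, forall i, P i y}].
Proof.
move=> FP; elim: s => [|j s IH]; first by apply: filterS filterT => y _ i.
apply: filterS2 (FP j) IH => y Pj Ps i; rewrite inE => /orP[/eqP->//|].
exact: Ps.
Qed.

(** * Clique norms *)

Section EuclideanSum.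
Context {R : realType} {I : choiceType}.
Implicit Types (f g : I -> R) (s : seq I).

Definition euc f s : R := Num.sqrt (\sum_(i <- s) f i ^+ 2).

Lemma euc_ge0 f s : 0 <= euc f s.
Proof. exact: sqrtr_ge0. Qed.

Lemma sqr_euc f s : euc f s ^+ 2 = \sum_(i <- s) f i ^+ 2.
Proof. by rewrite sqr_sqrtr// sumr_ge0// => i _; rewrite sqr_ge0. Qed.

Lemma euc_nil f : euc f [::] = 0.
Proof. by rewrite /euc big_nil sqrtr0. Qed.

Lemma ler_sqrt_sqr (a b : R) : 0 <= b -> a ^+ 2 <= b ^+ 2 -> a <= b.
Proof. by move=> b0 ab; nra. Qed.

Lemma eq_euc f g s : {in s, forall i, f i ^+ 2 = g i ^+ 2} -> euc f s = euc g s.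
Proof. by move=> fg; rewrite /euc; congr Num.sqrt; apply: eq_big_seq. Qed.

Lemma euc_cons f i s : euc f (i :: s) ^+ 2 = f i ^+ 2 + euc f s ^+ 2.
Proof. by rewrite !sqr_euc big_cons. Qed.

(** Cauchy-Schwarz in the plane, from the square of [a * d - b * c]. This is the induction step of
    [euc_triangle]: the second coordinate is the norm of the tail of the list. *)
Lemma planar_triangle (a b c d p q r : R) : 0 <= p -> 0 <= q -> 0 <= r ->
  0 <= c -> 0 <= d ->
  p ^+ 2 = a ^+ 2 + c ^+ 2 -> q ^+ 2 = b ^+ 2 + d ^+ 2 ->
  r ^+ 2 <= (a + b) ^+ 2 + (c + d) ^+ 2 -> r <= p + q.
Proof.
move=> p0 q0 r0 c0 d0 hp hq hr.
have pq : a * b + c * d <= p * q.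
  apply: ler_sqrt_sqr; first exact: mulr_ge0.
  rewrite exprMn hp hq.
  by have := sqr_ge0 (a * d - b * c); nra.
by apply: ler_sqrt_sqr; [exact: addr_ge0|nra].
Qed.

Lemma euc_triangle f g s : euc (f + g) s <= euc f s + euc g s.
Proof.
elim: s => [|i s IH]; first by rewrite !euc_nil addr0.
apply: (planar_triangle (a := f i) (b := g i) _ _ _ (euc_ge0 f s) (euc_ge0 g s));
  rewrite ?euc_ge0 ?euc_cons//.
rewrite lerD2l lerXn2r// nnegrE ?euc_ge0//.
by rewrite addr_ge0 ?euc_ge0.
Qed.

Lemma eucZ a f s : euc (a *: f) s = `|a| * euc f s.
Proof.
rewrite /euc (eq_bigr (fun i => a ^+ 2 * f i ^+ 2)); last first.
  by move=> i _; rewrite fctE -exprMn.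
by rewrite -mulr_sumr sqrtrM ?sqr_ge0// sqrtr_sqr.
Qed.

Lemma eucN f s : euc (- f) s = euc f s.
Proof. by apply: eq_euc => i _; rewrite fctE sqrrN. Qed.

Lemma sqr_euc_filterC (p : pred I) f s :
  euc f s ^+ 2 = euc f (seq.filter p s) ^+ 2 + euc f (seq.filter (predC p) s) ^+ 2.
Proof. by rewrite !sqr_euc !big_filter (bigID p). Qed.

Lemma euc_filter_le (p : pred I) f s : euc f (seq.filter p s) <= euc f s.
Proof.
apply: ler_sqrt_sqr; first exact: euc_ge0.
by rewrite (sqr_euc_filterC p f s) lerDl sqr_ge0.
Qed.

Lemma euc_filterC (p : pred I) f s :
  euc f s <= euc f (seq.filter p s) + euc f (seq.filter (predC p) s).
Proof.
have := sqr_euc_filterC p f s.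
have := euc_ge0 f (seq.filter p s); have := euc_ge0 f (seq.filter (predC p) s).
move=> a b h; apply: ler_sqrt_sqr; [exact: addr_ge0|nra].
Qed.

Lemma euc_le_sum f s : euc f s <= \sum_(i <- s) `|f i|.
Proof.
elim: s => [|i s IH]; first by rewrite euc_nil big_nil.
have h := euc_cons f i s; rewrite big_cons.
have n0 := normr_ge0 (f i); have e0 := euc_ge0 f s.
apply: le_trans (_ : `|f i| + euc f s <= _); last by rewrite lerD2l.
apply: ler_sqrt_sqr; first by rewrite addr_ge0.
by rewrite h -[f i ^+ 2](real_normK (num_real _)); nra.
Qed.

Lemma euc_ge_norm f s i : i \in s -> `|f i| <= euc f s.
Proof.
elim: s => // j s IH; rewrite inE => /orP[/eqP->|/IH h].
  apply: ler_sqrt_sqr; first exact: euc_ge0.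
  by rewrite euc_cons (real_normK (num_real _)) lerDl sqr_ge0.
apply: le_trans h _; apply: ler_sqrt_sqr; first exact: euc_ge0.
by rewrite euc_cons lerDr sqr_ge0.
Qed.

Lemma ler_sum_subset (F : I -> R) s t : (forall i, 0 <= F i) -> uniq s ->
  {subset s <= t} -> \sum_(i <- s) F i <= \sum_(i <- t) F i.
Proof.
move=> F0; elim: s t => [|x s IH] t /=; first by rewrite big_nil sumr_ge0.
move=> /andP[xs us] st; have xt : x \in t by apply: st; rewrite mem_head.
rewrite big_cons (big_rem x xt) lerD2l; apply: IH => // y ys.
apply: rem_mem; last by apply: st; rewrite inE ys orbT.
by apply: contraNneq xs => <-.
Qed.

Definition restr (C : set I) f : I -> R := fun i => if `[< C i >] then f i else 0.

Lemma restrT (C : set I) f i : C i -> restr C f i = f i.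
Proof. by rewrite /restr => /asboolP ->. Qed.

Lemma restrF (C : set I) f i : ~ C i -> restr C f i = 0.
Proof. by rewrite /restr; case: asboolP. Qed.

Lemma restrB (C : set I) f g : restr C (f - g) = restr C f - restr C g.
Proof. by apply/funext => i; rewrite !fctE /restr; case: asboolP; rewrite ?subr0. Qed.

Lemma restrZ (C : set I) a f : restr C (a *: f) = a *: restr C f.
Proof. by apply/funext => i; rewrite !fctE /restr; case: asboolP => //; rewrite scaler0. Qed.

Lemma restrC (C : set I) f : f = restr C f + restr (~` C) f.
Proof.
apply/funext => i; rewrite !fctE.
have [Ci|Ci] := pselect (C i).
  by rewrite (restrT _ Ci) (@restrF (~` C)) ?addr0// => /(_ Ci).
by rewrite (restrF _ Ci) (@restrT (~` C)) ?add0r.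
Qed.

Lemma euc_restr (C : set I) f s :
  euc (restr C f) s = euc f [seq i <- s | `[< C i >]].
Proof.
rewrite /euc big_filter; congr Num.sqrt; rewrite [RHS]big_mkcond; apply: eq_bigr => i _.
by rewrite /restr; case: asboolP => // _; rewrite expr0n.
Qed.

End EuclideanSum.

Section CliqueNorm.
Context {R : realType} {I : choiceType} (E : I -> I -> Prop).
Implicit Types (f g : I -> R) (s : seq I).

Definition clique s :=
  uniq s /\ (forall i j, i \in s -> j \in s -> i <> j -> E i j).

Definition cnorm f : R := sup [set euc f s | s in clique].

(* Membership in the closure of the finitely supported functions for the norm
   [cnorm], which is a junk value when the supremum is infinite. *)
Definition vanishing f := forall e : R, 0 < e -> exists s0 : seq I,
  forall s, clique s -> {in s, forall i, i \notin s0} -> euc f s <= e.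

Lemma clique_nil : clique [::].
Proof. by []. Qed.

Lemma clique1 i : clique [:: i].
Proof. by split=> // j k; rewrite !inE => /eqP-> /eqP->. Qed.

Lemma clique_filter (p : pred I) s : clique s -> clique (seq.filter p s).
Proof.
move=> [us Es]; split; first exact: filter_uniq.
by move=> i j; rewrite !mem_filter => /andP[_ si] /andP[_ sj]; exact: Es.
Qed.

(** Cut a clique by the finite set given for tolerance 1: the inner part is at most the sum of
    absolute values over that set, the outer part at most 1. *)
Lemma vanishing_bounded f : vanishing f ->
  exists M, forall s, clique s -> euc f s <= M.
Proof.
move=> /(_ 1 ltr01)[s0 h]; exists (\sum_(i <- s0) `|f i| + 1) => s cs.
apply: le_trans (euc_filterC (mem s0) f s) _; apply: lerD.
  apply: le_trans (euc_le_sum _ _) _; apply: ler_sum_subset => //.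
    by case: cs => us _; exact: filter_uniq.
  by move=> i; rewrite mem_filter => /andP[].
by apply: h => [|i]; [exact: clique_filter|rewrite mem_filter => /andP[]].
Qed.

Lemma euc_le_cnorm f s : vanishing f -> clique s -> euc f s <= cnorm f.
Proof.
move=> /vanishing_bounded[M hM] cs; apply: ub_le_sup; last by exists s.
by exists M => _ [t ct <-]; exact: hM.
Qed.

Lemma cnorm_le f M : (forall s, clique s -> euc f s <= M) -> cnorm f <= M.
Proof.
move=> h; apply: ge_sup; first by exists (euc f [::]); exists [::].
by move=> _ [s cs <-]; exact: h.
Qed.

Lemma cnorm_ge0 f : vanishing f -> 0 <= cnorm f.
Proof. by move=> /euc_le_cnorm /(_ clique_nil); rewrite euc_nil. Qed.

(** Needed for completeness: a coordinatewise limit has to be placed in the space before its [cnorm]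
    means anything. *)
Lemma vanishing_small f : (forall e : R, 0 < e -> exists2 g, vanishing g &
    forall s, clique s -> euc (f - g) s <= e) -> vanishing f.
Proof.
move=> h e e0; have e20 : 0 < e / 2 by rewrite divr_gt0.
have [g vg hg] := h _ e20; have [s0 hs0] := vg _ e20.
exists s0 => s cs ss0; rewrite -(subrK g f) [e]splitr.
by apply: le_trans (euc_triangle _ _ _) _; rewrite lerD ?hg// hs0.
Qed.

Lemma vanishingD f g : vanishing f -> vanishing g -> vanishing (f + g).
Proof.
move=> vf vg e e0; have e20 : 0 < e / 2 by rewrite divr_gt0.
have [s1 h1] := vf _ e20; have [s2 h2] := vg _ e20.
exists (s1 ++ s2) => s cs hs; rewrite [e]splitr.
apply: le_trans (euc_triangle _ _ _) _; apply: lerD.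
  by apply: h1 => // i /hs; rewrite mem_cat negb_or => /andP[].
by apply: h2 => // i /hs; rewrite mem_cat negb_or => /andP[].
Qed.

Lemma vanishingZ a f : vanishing f -> vanishing (a *: f).
Proof.
move=> vf e e0.
have a0 : 0 < `|a| + 1 by rewrite ltr_wpDl.
have [s0 h] := vf (e / (`|a| + 1)) (divr_gt0 e0 a0).
exists s0 => s cs hs; rewrite eucZ.
have := h s cs hs; rewrite ler_pdivlMr// => h1.
by have := euc_ge0 f s; have := normr_ge0 a; nra.
Qed.

Lemma vanishing0 : vanishing (0 : I -> R).
Proof.
move=> e e0; exists [::] => s _ _; rewrite /euc big1 ?sqrtr0 ?ltW// => i _.
exact: expr0n.
Qed.

Lemma cnorm0 : cnorm (0 : I -> R) = 0.
Proof.
apply/eqP; rewrite eq_le cnorm_ge0 ?andbT; last exact: vanishing0.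
apply: cnorm_le => s _; rewrite /euc big1 ?sqrtr0// => i _; exact: expr0n.
Qed.

Lemma vanishingN f : vanishing f -> vanishing (- f).
Proof. by rewrite -scaleN1r; exact: vanishingZ. Qed.

Lemma vanishingB f g : vanishing f -> vanishing g -> vanishing (f - g).
Proof. by move=> vf vg; apply: vanishingD => //; exact: vanishingN. Qed.

Lemma vanishing_restr C f : vanishing f -> vanishing (restr C f).
Proof.
move=> vf e /vf[s0 h]; exists s0 => s cs hs; rewrite euc_restr.
by apply: le_trans (euc_filter_le _ _ _) (h _ cs hs).
Qed.

Lemma vanishing_finite s0 f : (forall i, i \notin s0 -> f i = 0) -> vanishing f.
Proof.
move=> h e e0; exists s0 => s cs hs; rewrite /euc big1_seq ?sqrtr0 ?ltW//.
by move=> i /andP[_ /hs /h ->]; rewrite expr0n.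
Qed.

Lemma cnormD f g : vanishing f -> vanishing g ->
  cnorm (f + g) <= cnorm f + cnorm g.
Proof.
move=> vf vg; apply: cnorm_le => s cs.
by apply: le_trans (euc_triangle _ _ _) _; rewrite lerD ?euc_le_cnorm.
Qed.

Lemma cnormN f : cnorm (- f) = cnorm f.
Proof.
by congr sup; apply/seteqP; split=> _ [s cs <-]; exists s; rewrite ?eucN.
Qed.

Lemma cnormB f g : vanishing f -> vanishing g ->
  cnorm (f - g) <= cnorm f + cnorm g.
Proof. by move=> vf vg; rewrite -(cnormN g) cnormD//; exact: vanishingN. Qed.

Lemma cnormZ a f : vanishing f -> cnorm (a *: f) = `|a| * cnorm f.
Proof.
have le b g : vanishing g -> cnorm (b *: g) <= `|b| * cnorm g.
  by move=> vg; apply: cnorm_le => s cs; rewrite eucZ ler_wpM2l ?euc_le_cnorm.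
move=> vf; apply/eqP; rewrite eq_le le//=.
have [->|a0] := eqVneq a 0.
  by rewrite normr0 mul0r cnorm_ge0//; exact: vanishingZ.
have := le a^-1 _ (vanishingZ a vf).
rewrite scalerA mulVf// scale1r normfV.
by rewrite ler_pdivlMl ?normr_gt0.
Qed.

Lemma norm_le_cnorm f i : vanishing f -> `|f i| <= cnorm f.
Proof.
move=> vf; apply: le_trans (euc_le_cnorm vf (clique1 i)).
by apply: euc_ge_norm; rewrite inE.
Qed.

Lemma cnorm_eq0 f : vanishing f -> cnorm f = 0 -> f = 0.
Proof.
move=> vf f0; apply/funext => i; apply/eqP; rewrite -normr_le0 -f0.
exact: norm_le_cnorm.
Qed.

Lemma cnorm_restr_le C D f : vanishing f -> C `<=` D ->
  cnorm (restr C f) <= cnorm (restr D f).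
Proof.
move=> vf CD; apply: cnorm_le => s cs.
apply: le_trans (euc_le_cnorm (vanishing_restr D vf) cs).
rewrite !euc_restr.
have -> : [seq i <- s | `[< C i >]] =
    [seq i <- [seq i <- s | `[< D i >]] | `[< C i >]].
  rewrite -filter_predI; apply: eq_filter => i /=.
  by case: (asboolP (C i)) => // /CD Di; symmetry; apply/asboolP.
exact: euc_filter_le.
Qed.

Lemma restr_setT f : restr setT f = f.
Proof. by apply/funext => i; rewrite restrT. Qed.

Lemma cnorm_restr C f : vanishing f -> cnorm (restr C f) <= cnorm f.
Proof. by move=> vf; rewrite -[leRHS]/(cnorm f) -{2}(restr_setT f) cnorm_restr_le. Qed.

(** Singletons are cliques, so only finitely many coordinates exceed [1 / (n + 1)] in absolute
    value. *)
Lemma vanishing_countable f : vanishing f -> countable [set i | f i <> 0].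
Proof.
move=> vf.
have /choice[S hS] n : exists s0 : seq I, forall i, i \notin s0 ->
    `|f i| <= n.+1%:R^-1.
  have [s0 h] := vf n.+1%:R^-1 ltac:(by rewrite invr_gt0).
  exists s0 => i si; apply: le_trans (h [:: i] (clique1 i) _).
    by apply: euc_ge_norm; rewrite inE.
  by move=> j; rewrite inE => /eqP->.
apply: (@sub_countable _ _ _ (\bigcup_n [set` S n])).
  apply: subset_card_le => i /= fi; apply: contrapT => nS; apply: fi.
  apply/eqP; rewrite -normr_le0; apply/ler_addgt0Pl => e e0; rewrite addr0.
  have [n] := ltr_add_invr e0; rewrite add0r => /ltW; apply: le_trans.
  by apply: hS; apply/negP => iS; apply: nS; exists n.
by apply: bigcup_countable => // n _; exact: finite_set_countable.
Qed.
End CliqueNorm.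

(** * The Banach space of vanishing functions *)

Section CliqueSpace.
Context (R : realType) (I : choiceType) (E : I -> I -> Prop).

Definition vanishing_pred : {pred I -> R} := [pred f | `[< vanishing E f >]].

Record cliqueSpace := CliqueSpace {
  cfun :> I -> R;
  _ : cfun \in vanishing_pred }.

HB.instance Definition _ := [isSub for cfun].
HB.instance Definition _ := [Choice of cliqueSpace by <:].

Lemma vanishing_predP f : (f \in vanishing_pred) <-> vanishing E f.
Proof. by split=> [/asboolW//|vf]; exact: asboolT. Qed.

Lemma vanishing_submod : GRing.submod_closed vanishing_pred.
Proof.
split; first by apply/vanishing_predP; exact: vanishing0.
move=> a f g /vanishing_predP vf /vanishing_predP vg; apply/vanishing_predP.
by apply: vanishingD => //; exact: vanishingZ.
Qed.

HB.instance Definition _ :=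
  GRing.isSubmodClosed.Build R (I -> R) vanishing_pred vanishing_submod.
HB.instance Definition _ := [SubChoice_isSubLmodule of cliqueSpace by <:].

Lemma cfunP (x : cliqueSpace) : vanishing E x.
Proof. by apply/vanishing_predP; case: x. Qed.

Lemma cfunB (x y : cliqueSpace) : x - y = (x : I -> R) - y :> (I -> R).
Proof. by []. Qed.

Lemma evalB (x y : cliqueSpace) i : (x - y) i = x i - y i.
Proof. by []. Qed.

Lemma cnorm_cfunD (x y : cliqueSpace) : cnorm E (x + y) <= cnorm E x + cnorm E y.
Proof. exact: cnormD (cfunP x) (cfunP y). Qed.

Lemma cnorm_cfunZ (a : R) (x : cliqueSpace) : cnorm E (a *: x) = `|a| * cnorm E x.
Proof. exact: cnormZ (cfunP x). Qed.

Lemma cnorm_cfun0 (x : cliqueSpace) : cnorm E x = 0 -> x = 0.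
Proof. by move=> /(cnorm_eq0 (cfunP x)) x0; apply: val_inj. Qed.

HB.instance Definition _ := @Lmodule_isNormed.Build R cliqueSpace
  (fun x => cnorm E x) cnorm_cfunD cnorm_cfunZ cnorm_cfun0.

Lemma normE (x : cliqueSpace) : `|x| = cnorm E x.
Proof. by []. Qed.

Lemma euc_le_norm (x : cliqueSpace) s : clique E s -> euc x s <= `|x|.
Proof. exact: euc_le_cnorm (cfunP x). Qed.

Lemma eval_le_norm (x : cliqueSpace) i : `|x i| <= `|x|.
Proof. exact: norm_le_cnorm (cfunP x). Qed.

(** Evaluations are 1-Lipschitz, so a Cauchy filter converges coordinatewise. An estimate over one
    clique involves finitely many coordinates, hence survives the limit with a constant independent
    of the clique. *)
Lemma cliqueSpace_complete (F : set_system cliqueSpace) :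
  ProperFilter F -> cauchy F -> cvg F.
Proof.
move=> FF /cauchyP Fc.
have ball_dist (x0 y : cliqueSpace) e : ball x0 e y -> `|x0 - y| < e.
  by rewrite -ball_normE.
have ev i : cvg ((fun x : cliqueSpace => x i) @ F).
  apply: cauchy_cvg; apply/cauchyP => e /Fc[x0 Fx0]; exists (x0 i).
  rewrite -[_ _]/(F (fun y : cliqueSpace => ball (x0 i) e (y i))).
  apply: filterS Fx0 => y /ball_dist; rewrite -ball_normE; apply: le_lt_trans.
  by have := eval_le_norm (x0 - y) i; rewrite cfunB.
pose g i := lim ((fun x : cliqueSpace => x i) @ F).
have close e x0 s : F (ball x0 e) -> clique E s -> euc (g - x0) s <= e.
  move=> Fx0 cs; apply/ler_addgt0Pr => d d0.
  (* Errors of at most [d'] on the [size s] coordinates add up to at most [d]; the successor keeps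
     the denominator nonzero. *)
  pose d' := d / (size s).+1%:R.
  have d'0 : 0 < d' by rewrite divr_gt0.
  have /(filter_all_in s) Fs : forall i, F [set y : cliqueSpace | `|g i - y i| <= d'].
    by move=> i; have /cvgrPdist_le/(_ _ d'0) := ev i.
  have [y [ys /ball_dist yx0]] := filter_ex (filterI Fs Fx0).
  have -> : g - x0 = (g - y) + ((y : I -> R) - x0) by rewrite addrA subrK.
  rewrite [leRHS]addrC.
  apply: le_trans (euc_triangle _ _ _) _; apply: lerD.
    apply: le_trans (euc_le_sum _ _) _.
    apply: le_trans (_ : \sum_(i <- s) d' <= _).
      by rewrite big_seq [leRHS]big_seq; apply: ler_sum => i si; exact: ys.
    rewrite big_const_seq count_predT iter_addr_0 -mulr_natl mulrCA ler_piMr ?(ltW d0)//.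
    by rewrite ler_pdivrMr// mul1r ler_nat.
  apply: le_trans (ltW yx0); rewrite distrC.
  by have := euc_le_norm (y - x0) cs; rewrite cfunB.
have vg : vanishing E g.
  apply: vanishing_small => e /Fc[x0 Fx0].
  by exists x0 => [|s cs]; [exact: cfunP|exact: close].
pose G := CliqueSpace ((vanishing_predP g).2 vg).
apply/cvg_ex; exists G; apply/cvgrPdist_le => e e0.
have [x0 Fx0] := Fc _ (divr_gt0 e0 (ltr0n R 2)).
apply: filterS (Fx0) => y yx0; rewrite [e]splitr -(subrK x0 G) -addrA.
apply: le_trans (ler_normD _ _) _; apply: lerD; last exact/ltW/ball_dist.
by apply: cnorm_le => s; exact: close.
Qed.

HB.instance Definition _ :=
  Uniform_isComplete.Build cliqueSpace cliqueSpace_complete.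

End CliqueSpace.

(** * Generic graphs from a nonmeager set *)

Section Guessing.
Context {R : realType}.
Implicit Types (x : R) (n w : nat).

(** The integer is read off the fractional part of [(n + 1) x]: it is [w] when that part lies
    strictly between [1 / (w + 2)] and [1 / (w + 1)]. So each value fills an open interval in every
    period of length [1 / (n + 1)]. *)
Definition guess x n : nat :=
  (Num.truncn (n.+1%:R * x - (Num.floor (n.+1%:R * x))%:~R)^-1).-1.

Lemma guess_eq x n w (m : int) :
  w.+2%:R^-1 < n.+1%:R * x - m%:~R < w.+1%:R^-1 -> guess x n = w.
Proof.
move=> /andP[v1 v2]; rewrite /guess.
have w2 : (0 : R) < w.+2%:R^-1 by rewrite invr_gt0.
have w1 : w.+1%:R^-1 <= (1 : R) by rewrite invf_le1// ler1n.
have -> : Num.floor (n.+1%:R * x) = m.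
  apply: floor_def; rewrite intrD1 -subr_ge0 -ltrBlDl.
  by rewrite (ltW (lt_trans w2 v1)) (lt_le_trans v2 w1).
move: (_ - _) v1 v2 => v v1 v2; have v0 : 0 < v by exact: lt_trans v1.
rewrite (@truncn_def _ _ w.+1)//; apply/andP; split.
  by rewrite -[leLHS]invrK lef_pV2 ?posrE ?invr_gt0// ltW.
by rewrite -[ltRHS]invrK ltf_pV2 ?posrE ?invr_gt0.
Qed.

(** For large [n] in [P] every ball contains an open interval on which [guess] at time [n] is [W n],
    and the set misses that interval. *)
Lemma never_guessed_nowhere_dense (P : set nat) (W : nat -> nat) :
  (forall N, exists2 n, (N <= n)%N & P n) ->
  nowhere_dense [set x | forall n, P n -> guess x n <> W n].
Proof.
move=> infP; rewrite /nowhere_dense -subset0 => x.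
rewrite /interior/= -nbhs_ballE => -[e /= e0 xe].
have [N] := ltr_add_invr (divr_gt0 e0 (ltr0n R 2)); rewrite add0r => Ne.
have [n Nn Pn] := infP N.
have n0 : (0 : R) < n.+1%:R by [].
have ne : n.+1%:R^-1 < e / 2.
  apply: le_lt_trans Ne; rewrite lef_pV2 ?posrE// ler_nat; lia.
pose m : R := (Num.floor (n.+1%:R * x))%:~R.
have /andP[m1] := floor_itv (n.+1%:R * x); rewrite intrD1 -/m => m2.
pose w : R := (W n).+1%:R^-1; pose w' : R := (W n).+2%:R^-1.
have w'0 : 0 < w' by rewrite invr_gt0.
have w'w : w' < w by rewrite ltf_pV2 ?posrE// ltr_nat.
have w1 : w <= 1 by rewrite invf_le1// ler1n.
pose d := n.+1%:R^-1 : R.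
have d0 : 0 < d by rewrite invr_gt0.
have nd : n.+1%:R * d = 1 by rewrite mulfV// gt_eqF.
(* Midpoint of the interval of correct guesses in the period following that of [x]; it is at
   distance less than [2 * d < e] from [x]. *)
pose p := (m + 1 + (w + w') / 2) * d.
have pe : ball x e p.
  rewrite /ball/= ltr_norml.
  have -> : x = (n.+1%:R * x) * d by rewrite mulrAC nd mul1r.
  have h1 : n.+1%:R * x * d - p = (n.+1%:R * x - (m + 1 + (w + w') / 2)) * d.
    by rewrite /p mulrBl.
  rewrite h1; set q := _ - _.
  have q1 : - 2 < q by rewrite /q; lra.
  have q2 : q < 2 by rewrite /q; lra.
  by rewrite -/d in ne; apply/andP; split; nra.
have := xe _ pe.
move=> /(_ (ball p (d * (w - w') / 2))).
case=> [|y [Ay]]; first by apply: nbhsx_ballx; rewrite divr_gt0// mulr_gt0// subr_gt0.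
rewrite /ball/= ltr_norml => /andP[y1 y2].
apply: (Ay n Pn); apply: (@guess_eq _ _ _ (Num.floor (n.+1%:R * x) + 1)).
rewrite intrD1 -/m -/w -/w'.
pose u : R := n.+1%:R * y.
have yd : (y : R) = u * d by rewrite mulrAC nd mul1r.
have u1 : - (d * (w - w') / 2) < (m + 1 + (w + w') / 2) * d - u * d :> R.
  by rewrite -yd.
have u2 : (m + 1 + (w + w') / 2) * d - u * d < d * (w - w') / 2 :> R.
  by rewrite -yd.
rewrite -/u; clearbody d m w w' u.
have k1 : - ((w - w') / 2) < m + 1 + (w + w') / 2 - u.
  by rewrite -(ltr_pM2r d0); lra.
have k2 : m + 1 + (w + w') / 2 - u < (w - w') / 2.
  by rewrite -(ltr_pM2r d0); lra.
by apply/andP; split; lra.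
Qed.

(** Otherwise [A] is covered by countably many nowhere dense sets, the one of index [q] being the
    reals that never guess [W] on class [q] from time [n0] on. *)
Lemma nonmeager_guess (A : set R) (cls W : nat -> nat) : ~ meager A ->
  (forall q N, exists2 n, (N <= n)%N & cls n = q) -> forall n0 : nat,
  exists2 x, A x &
    forall q, exists n, [/\ (n0 <= n)%N, cls n = q & guess x n = W n].
Proof.
move=> mA inf n0; apply: contrapT => no; apply: mA.
exists (fun q => [set x | forall n, (n0 <= n)%N /\ cls n = q -> guess x n <> W n]).
split=> [q|x Ax].
  apply: (never_guessed_nowhere_dense (P := [set n | (n0 <= n)%N /\ cls n = q])).
  move=> N; have [n Nn nq] := inf q (maxn n0 N).
  by exists n => /=; [|split=> //]; lia.
apply: contrapT => nx; apply: no; exists x => // q; apply: contrapT => nq.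
by apply: nx; exists q => // n [n0n nq'] gx; apply: nq; exists n.
Qed.

End Guessing.

(** * Orders of type omega_1 and dense families of labellings *)

Section Omega1.
Context {T : Type} (A : set T) (lt : T -> T -> Prop).
Hypothesis wA : omega1_order A lt.

Lemma omega1_wf : well_founded (fun x y => [/\ A x, A y & lt x y]).
Proof.
have [_ _ _ minA _] := wA.
suff acc x : A x -> Acc (fun x y => [/\ A x, A y & lt x y]) x.
  by move=> x; constructor => y [Ay _ _]; exact: acc.
move=> Ax; apply: contrapT => nx.
have [||m [Am nm] mmin] := minA [set y | A y /\ ~ Acc (fun x y => [/\ A x, A y & lt x y]) y].
- by move=> y [].
- by exists x.
apply: nm; constructor => y [Ay _ ym]; apply: contrapT => ny.
exact: (mmin y).
Qed.

(** Transfinite recursion along [A]: the values used before [x] form a countable set, so the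
    uncountable [B] still has a fresh one. *)
Lemma omega1_injection (U : choiceType) (B : set U) : ~ countable B ->
  exists f : T -> U, (forall x, A x -> B (f x)) /\
    (forall x y, A x -> A y -> f x = f y -> x = y).
Proof.
move=> cB; have [_ _ tot _ seg] := wA.
have [u0 Bu0] : B !=set0.
  by apply/set0P; apply/negP => /eqP B0; apply: cB; rewrite B0; exact: countable0.
pose r x y := [/\ A x, A y & lt x y].
pose F x (rec : forall y, r y x -> U) :=
  xget u0 (B `\` [set u | exists y (h : r y x), u = rec y h]).
pose f := Fix omega1_wf (fun=> U) F.
have fE x : f x = F x (fun y _ => f y).
  apply: (Fix_eq omega1_wf (fun=> U) F) => z g h gh; congr (xget _ (_ `\` _)).
  by apply/seteqP; split=> u [y [p ->]]; exists y, p.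
have fP x : A x -> (B `\` [set u | exists y (h : r y x), u = f y]) (f x).
  move=> Ax; rewrite fE /F; case: xgetP => [y _ []//|] no.
  exfalso; apply: cB.
  apply: (@sub_countable _ _ _ (f @` [set y | A y /\ lt y x])).
    apply: subset_card_le => u Bu; apply: contrapT => nu; apply: (no u).
    by split=> // -[y [[Ay _ yx] uy]]; apply: nu; exists y.
  exact: sub_countable (card_image_le _ _) (seg x Ax).
exists f; split=> [x /fP[]//|x y Ax Ay fxy].
have [xy|//|yx] := tot x y Ax Ay.
  by have [_ []] := fP y Ay; exists x, (And3 Ax Ay xy).
by have [_ []] := fP x Ax; exists y, (And3 Ay Ax yx).
Qed.

End Omega1.

Lemma floors_separate (R : realType) (x y : R) : x <> y ->
  \forall N \near \oo, Num.floor (N%:R * x) <> Num.floor (N%:R * y).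
Proof.
move=> xy; have d0 : 0 < `|x - y| by rewrite normr_gt0 subr_eq0; exact/eqP.
have [K] := ltr_add_invr d0; rewrite add0r => Kd.
exists K.+1 => // N /= KN fl.
have /andP[x1 x2] := floor_itv (N%:R * x).
have /andP[y1 y2] := floor_itv (N%:R * y).
rewrite fl !intrD1 in x1 x2 y1 y2.
have N0 : (0 : R) < N%:R by rewrite ltr0n; exact: leq_trans KN.
have : N%:R * `|x - y| < 1.
  rewrite -[N%:R]gtr0_norm// -normrM mulrBr ltr_norml.
  by apply/andP; split; lra.
apply/negP; rewrite -leNgt -ler_pdivrMl// mulr1.
apply: le_trans (ltW Kd); rewrite lef_pV2 ?posrE// ler_nat//.
Qed.

(** A countable dense family in a product of copies of the naturals, as in the
    Hewitt-Marczewski-Pondiczery theorem. A labelling is a finite table indexed by the floors of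
    [N * g i]; a large [N] separates any given finite list of vertices. *)
Lemma dense_labellings (R : realType) (I : choiceType) (g : I -> R) :
  injective g -> exists h : nat -> I -> nat,
  forall (s : seq I) (v : I -> nat), uniq s ->
    exists q, {in s, forall i, h q i = v i}.
Proof.
move=> ginj.
pose h q i := let '(N, zs, vs) := odflt (0%N, [::], [::])
    (unpickle q : option (nat * seq int * seq nat)) in
  nth 0%N vs (index (Num.floor (N%:R * g i)) zs).
exists h => s v us.
have sep i j : \forall N \near \oo,
    i <> j -> Num.floor (N%:R * g i) <> Num.floor (N%:R * g j).
  have [->|ij] := pselect (i = j); first by apply: nearW => N /= /(_ erefl).
  have := floors_separate (fun e => ij (ginj _ _ e)).
  by apply: filterS => N.
have [N _ /(_ N (leqnn N)) /= sepN] :=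
  filter_all_in s (fun i => filter_all_in s (sep i)).
pose fl i := Num.floor (N%:R * g i).
exists (pickle (N, map fl s, map v s)) => i si; rewrite /h pickleK /=.
have finj : {in s &, injective fl}.
  by move=> j k sj sk fjk; apply: contrapT => /(sepN j sj k sk).
rewrite -/(fl i) (nth_map i) ?nth_index_map//.
by rewrite -(size_map fl) index_mem map_f.
Qed.

(* At time [n] a vertex obeys a request about at most [req_cap n] smaller
   vertices.  This is room for [n * req_total n + 1] blocks of size [n], one
   more than what the requests of all earlier times can spoil for [n] vertices
   simultaneously. *)
Fixpoint req_total n : nat :=
  if n is n'.+1 then (req_total n' + n' * (n' * req_total n').+1)%N else 0%N.

Definition req_cap n : nat := (n * (n * req_total n).+1)%N.

Lemma req_totalE n : req_total n = (\sum_(m < n) req_cap m)%N.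
Proof.
by elim: n => [|n IH]; rewrite ?big_ord0// big_ord_recr /= -IH.
Qed.

Lemma card_bigcup_seq (J : finType) (T : Type) (r : seq T) (F : T -> {set J}) :
  (#|\big[@finset.setU J/finset.set0]_(i <- r) F i| <= \sum_(i <- r) #|F i|)%N.
Proof.
elim: r => [|i r IH]; first by rewrite !big_nil cards0.
rewrite !big_cons; apply: leq_trans (leq_card_setU _ _) _.
by rewrite leq_add2l.
Qed.

Lemma countableU T (A B : set T) : countable A -> countable B -> countable (A `|` B).
Proof. by move=> cA cB; rewrite -bigcup2E; apply: bigcup_countable => // -[|[|n]]. Qed.

(** * A colouring that answers finite requests *)

Section Coloring.
Context {R : realType} {I : choiceType} (lt : I -> I -> Prop).
Hypothesis wI : omega1_order [set: I] lt.
Variables (A : set R) (ltA : R -> R -> Prop).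
Hypotheses (mA : ~ meager A) (wA : omega1_order A ltA).

Lemma countable_initial (a : I) : countable [set b | ~ lt a b].
Proof.
have [_ _ tot _ seg] := wI.
apply: (@sub_countable _ _ _ ([set a] `|` [set b | lt b a])).
  by apply: subset_card_le => b nab; have [//|->|] := tot a b Logic.I Logic.I; [left|right].
apply: countableU; first exact: countable1.
apply: sub_countable (seg a Logic.I); apply: subset_card_le.
by move=> b ba; split.
Qed.

(* [c i al] is decided by the first time at which [al] is asked about [i].  The
   vertex [al] numbers the guesses [(x, d)] available to it; the labelling [h]
   attached to the time selects one number for each [al], so that at suitable
   times the vertices of [tops] all consult the same guess.  The parity of the
   class of the time is the requested value. *)
Lemma coloring : exists c : I -> I -> Prop,
  forall k (d : I) (a : nat -> seq I),
    (forall s, size (a s) = k) ->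
    (forall s t i, i \in a s -> i \in a t -> s = t) ->
    (forall s, {in a s, forall i, lt i d}) ->
  exists2 G : set I, countable G &
  forall tops : seq I, uniq tops -> size tops = k ->
    {in tops, forall i, ~ G i} -> forall b : bool, exists s,
    {in a s, forall i, {in tops, forall j, lt i j /\ (c i j <-> b)}}.
Proof.
have [_ [_ trans] _ _ seg] := wI.
have [f [_ finj]] := omega1_injection wA (let: And5 h _ _ _ _ := wI in h).
have [g [_ ginj]] := omega1_injection wI (let: And5 h _ _ _ _ := wA in h).
have [h hP] := dense_labellings (fun x y => ginj x y Logic.I Logic.I).
(* The guesses open to [al]: a real and a bound whose positions lie below [al]. There are countably
   many, so [num al] can number them. *)
pose P al : set (R * I) := [set p | [/\ A p.1, lt (f p.1) al & lt p.2 al]].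
have /choice[num numP] : forall al, exists num : R * I -> nat,
    {in P al &, injective num}.
  move=> al; apply/countable_injP.
  have cI : countable [set b | lt b al].
    by apply: sub_countable (seg al Logic.I); apply: subset_card_le => b ba; split.
  have cA : countable [set x | A x /\ lt (f x) al].
    have /countable_injP[u uinj] := cI.
    apply/countable_injP; exists (u \o f) => x y.
    rewrite !inE => -[Ax fx] [Ay fy] /= uxy; apply: finj => //.
    by apply: uinj; rewrite ?inE.
  apply: sub_countable (countableX cA cI); apply: subset_card_le.
  by move=> [x d] /= [Ax fx dal].
have /choice[io ioP] : forall d, exists io : I -> nat,
    {in [set b | lt b d] &, injective io}.
  move=> d; apply/countable_injP.
  by apply: sub_countable (seg d Logic.I); apply: subset_card_le => b ba; split.
(* The 2-adic valuation splits the times into infinitely many infinite classes. A class encodes a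
   labelling by its half and a requested value by its parity. *)
pose cls n := logn 2 n.
have clsinf q N : exists2 n, (N <= n)%N & cls n = q.
  exists (2 ^ q * (2 * N).+1)%N; first by rewrite mulnS; nia.
  rewrite /cls lognM ?expn_gt0// pfactorK// logn_coprime ?addn0//.
  by rewrite coprime2n /= mul2n odd_double.
pose code (w : nat) : seq nat := odflt [::] (unpickle w).
have codeK l : code (pickle l) = l by rewrite /code pickleK.
(* Since [num al] is injective on [P al], a single [p] is consulted by [al] at time [n]; this is why
   the truncated list bounds the number of mentioned vertices. *)
pose mention n al xi := exists p, [/\ P al p, num al p = h (cls n)./2 al,
  lt xi p.2 & io p.2 xi \in take (req_cap n) (code (guess p.1 n))].
have mention_few n al (J : finType) (B : {set J}) (e : J -> I) :
    {in B &, injective e} -> (forall j, j \in B -> mention n al (e j)) ->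
    (#|B| <= req_cap n)%N.
  move=> einj Bm; have [->|[j0 Bj0]] := set_0Vmem B; first by rewrite cards0.
  have [p [Pp nump _ _]] := Bm _ Bj0.
  have Bp j : j \in B -> lt (e j) p.2 /\
      io p.2 (e j) \in take (req_cap n) (code (guess p.1 n)).
    move=> /Bm[p' [Pp' nump' l' m']]; suff <- : p' = p by [].
    by apply: (numP al); rewrite ?inE// nump nump'.
  rewrite cardE -(size_map (io p.2 \o e)).
  apply: leq_trans (_ : size (take (req_cap n) (code (guess p.1 n))) <= _)%N.
    apply: uniq_leq_size.
      rewrite map_inj_in_uniq ?enum_uniq// => i j.
      rewrite !mem_enum => Bi Bj /= ij; apply: einj => //.
      by apply: (ioP p.2) => //; rewrite inE; [exact: (Bp i Bi).1|exact: (Bp j Bj).1].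
    move=> z /mapP[j]; rewrite mem_enum => Bj ->; exact: (Bp j Bj).2.
  by rewrite size_take; case: ltnP.
pose c xi al := exists n, [/\ mention n al xi,
  forall m, (m < n)%N -> ~ mention m al xi & odd (cls n)].
exists c => k d a sz_a disj_a a_d.
(* What a correct guess codes at time [n]: the first [k * req_total n + 1] blocks. The list fits
   into [req_cap n] entries as soon as [k <= n]. *)
pose W n := pickle [seq io d i | s <- iota 0 (k * req_total n).+1, i <- a s].
have [x Ax xP] := nonmeager_guess W mA clsinf k.
exists [set al | ~ lt (f x) al \/ ~ lt d al].
  by apply: countableU; exact: countable_initial.
move=> tops utops sz_tops topsG b.
have Ptops : {in tops, forall al, P al (x, d)}.
  by move=> al /topsG; rewrite /= -not_andP => /contrapT[].
have [q hq] := hP tops (fun al => num al (x, d)) utops.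
(* The half of this class is [q], so all of [tops] consult [(x, d)]; its parity is [b]. *)
have [n [kn cn gn]] := xP (b + q.*2)%N.
have mentioned s : (s < (k * req_total n).+1)%N ->
    {in a s, forall xi, {in tops, forall al, mention n al xi}}.
  move=> ss xi xis al ta; exists (x, d); split; first exact: Ptops.
  - by rewrite cn half_bit_double hq.
  - exact: a_d xis.
  rewrite gn codeK take_oversize; last first.
    rewrite size_allpairs_dep (eq_map (g := fun=> k)) //.
    rewrite (_ : sumn _ = (k * req_total n).+1 * k)%N; last first.
      by rewrite sumnE big_map big_const_seq count_predT iter_addn_0 size_iota mulnC.
    by rewrite /req_cap mulnC leq_mul// ltnS leq_mul.
  by apply/allpairsPdep; exists s, xi; rewrite mem_iota.
(* Blocks spoiled for [al] at the earlier time [m]. Disjoint blocks have distinct mentioned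
   vertices, hence at most [req_cap m] are spoiled; over all [m < n] and all [k] vertices of [tops]
   that makes at most [k * req_total n], one fewer than available. *)
pose Bad m al : {set 'I_(k * req_total n).+1} :=
  finset.finset (fun s : 'I_(k * req_total n).+1 =>
    `[< exists2 xi, xi \in a s & mention m al xi >]).
have Bad_le m al : (#|Bad m al| <= req_cap m)%N.
  have /choice[e eP] (s : 'I_(k * req_total n).+1) : exists xi,
      s \in Bad m al -> xi \in a s /\ mention m al xi.
    have [|sB] := boolP (s \in Bad m al); last by exists d.
    by rewrite inE => /asboolP[xi ? ?]; exists xi.
  apply: (mention_few _ al _ _ e) => [s t sB tB est|s /eP[]//].
  have [es _] := eP s sB; have [et _] := eP t tB.
  by apply/val_inj/(disj_a _ _ (e s)); rewrite // est.
pose AllBad := \big[@finset.setU _/finset.set0]_(al <- tops)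
  \big[@finset.setU _/finset.set0]_(m < n) Bad m al.
have [s snB] : exists s, s \notin AllBad.
  apply: contrapT => all; have : (#|[set: 'I_(k * req_total n).+1]%SET| <= #|AllBad|)%N.
    apply/subset_leq_card/fintype.subsetP => s _.
    by apply: contrapT => /negP ?; apply: all; exists s.
  rewrite cardsT card_ord leqNgt ltnS => /negP; apply.
  apply: leq_trans (card_bigcup_seq _ _) _.
  apply: leq_trans (_ : \sum_(al <- tops) req_total n <= _)%N; last first.
    by rewrite big_const_seq count_predT iter_addn_0 sz_tops mulnC.
  apply: leq_sum => al _; apply: leq_trans (card_bigcup_seq _ _) _.
  apply: leq_trans (_ : \sum_(m < n) req_cap m <= _)%N.
    by apply: leq_sum => m _; exact: Bad_le.
  by rewrite -req_totalE.
exists s => xi xis al ta; have Pal := Ptops al ta.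
have xid := a_d s xi xis; split.
  by case: Pal => _ _; exact: (trans _ _ _ Logic.I Logic.I Logic.I xid).
have mn := mentioned s (ltn_ord s) xi xis al ta.
have first_mention m : (m < n)%N -> ~ mention m al xi.
  move=> mn' mm; move/negP: snB; apply.
  rewrite /AllBad (big_rem al)//= inE; apply/orP; left.
  apply/finset.bigcupP; exists (Ordinal mn') => //; rewrite inE; apply/asboolP.
  by exists xi.
have oddn : odd (cls n) = b by rewrite cn oddD odd_double addbF oddb.
split=> [[m [mm ml om]]|bt].
  suff nm : n = m by rewrite -oddn nm.
  have [mn'|nm'|//] := ltngtP n m; first by case: (ml n mn').
  by case: (first_mention m nm').
by exists n; split=> //; rewrite oddn.
Qed.

End Coloring.

(** * Spread families of finite sets *)

Section Spread.
Context {I : choiceType} {T : Type}.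
Implicit Types (S : T -> seq I) (Z : set T) (C : set I).

Definition avoiding S C : set T := [set t | forall i, i \in S t -> ~ C i].

(* The negligible sets, i.e. those that are not [spread], form a sigma-ideal. *)
Definition spread S Z := forall C, countable C -> ~ countable (Z `&` avoiding S C).

Lemma spread_sub S Z Z' : Z `<=` Z' -> spread S Z -> spread S Z'.
Proof.
move=> ZZ' sZ C /sZ; apply: contra_not; apply: sub_countable.
by apply: subset_card_le => t [/ZZ' ? ?].
Qed.

(** If every class were negligible, the union of the witnessing countable sets would witness that
    [Z] is negligible. *)
Lemma spread_pigeonhole S Z (lab : T -> nat) : spread S Z ->
  exists n, spread S (Z `&` [set t | lab t = n]).
Proof.
move=> sZ; apply: contrapT => no.
have /choice[C CP] n : exists C, countable C /\
    countable (Z `&` [set t | lab t = n] `&` avoiding S C).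
  apply: contrapT => nC; apply: no; exists n => C cC cZ.
  by apply: nC; exists C.
apply: (sZ (\bigcup_n C n)); first by apply: bigcup_countable => // n _; exact: (CP n).1.
apply: (@sub_countable _ _ _
    (\bigcup_n (Z `&` [set t | lab t = n] `&` avoiding S (C n)))).
  apply: subset_card_le => t [Zt tC]; exists (lab t) => //; split=> // i St Ci.
  by apply: (tC i St); exists (lab t).
by apply: bigcup_countable => // n _; exact: (CP n).2.
Qed.

Lemma spread_avoiding S Z C : countable C -> spread S Z ->
  spread S (Z `&` avoiding S C).
Proof.
move=> cC sZ D cD; have := sZ _ (countableU cC cD); apply: contra_not.
apply: sub_countable; apply: subset_card_le => t [Zt tCD].
by split; [split=> // i /tCD nCD Ci|move=> i /tCD nCD Di]; apply: nCD; [left|right].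
Qed.

Lemma spread_setD S Z K : countable K -> spread S Z -> spread S (Z `\` K).
Proof.
move=> cK sZ C cC cZ; apply: (sZ C cC).
apply: sub_countable (countableU cZ cK); apply: subset_card_le => t [Zt tC].
by have [Kt|Kt] := pselect (K t); [right|left].
Qed.

Lemma spread_nonempty S Z : spread S Z -> Z !=set0.
Proof.
move=> /(_ set0 (countable0 _)) sZ; apply/set0P/eqP => Z0.
by apply: sZ; rewrite Z0 set0I; exact: countable0.
Qed.

(** If only countably many members avoided [C], then [C] and the union of their supports would form
    a countable set. A member avoiding that set would be one of them, yet its support is
    nonempty. *)
Lemma uncountable_spread S Z : (forall t, Z t -> S t != [::]) ->
  (forall C, countable C -> Z `&` avoiding S C !=set0) -> spread S Z.
Proof.
move=> S0 avZ C cC cZ.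
have [|t [Zt tP]] := avZ (C `|` \bigcup_(t in Z `&` avoiding S C) [set` S t]).
  apply: countableU => //; apply: bigcup_countable => // t _.
  exact: finite_set_countable.
have := S0 t Zt; case St: (S t) => [//|i r] _.
have iS : i \in S t by rewrite St mem_head.
apply: (tP i iS); right; exists t => //; split=> // j /tP nj Cj.
by apply: nj; left.
Qed.

Lemma uncountable_pigeonhole Z (lab : T -> nat) : ~ countable Z ->
  exists n, ~ countable (Z `&` [set t | lab t = n]).
Proof.
move=> cZ; apply: contrapT => no; apply: cZ.
apply: (@sub_countable _ _ _ (\bigcup_n (Z `&` [set t | lab t = n]))).
  by apply: subset_card_le => t Zt; exists (lab t).
apply: bigcup_countable => // n _; apply: contrapT => nn; apply: no.
by exists n.
Qed.

(* A weak Delta-system lemma: [D] is a root of maximal size. *)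
Lemma root_lemma S Z : ~ countable Z -> (forall t, uniq (S t)) ->
  exists D : seq I, exists2 Z', Z' `<=` Z & (forall t, Z' t -> {subset D <= S t})
    /\ spread (fun t => [seq i <- S t | i \notin D]) Z'.
Proof.
move=> cZ uS; have [k cZk] := uncountable_pigeonhole (fun t => size (S t)) cZ.
pose above (D : seq I) := Z `&` [set t | size (S t) = k] `&` [set t | {subset D <= S t}].
pose P d := `[< exists D, [/\ uniq D, size D = d & ~ countable (above D)] >].
have exP : exists d, P d.
  exists 0%N; apply/asboolP; exists [::]; split=> // cab; apply: cZk.
  by apply: sub_countable cab; apply: subset_card_le => t Zt; split.
have ubP d : P d -> (d <= k)%N.
  move=> /asboolP[D [uD <- cD]].
  have [t [[_ /= <-] Dt]] : above D !=set0.
    by apply/set0P/eqP => D0; apply: cD; rewrite D0; exact: countable0.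
  exact: uniq_leq_size.
case: (ex_maxnP exP ubP) => d /asboolP[D [uD sD cD]] maxd.
exists D, (above D); first by move=> t [[]].
split=> [t []//|C cC cZC]; apply: cD.
set U := above D `&` _ in cZC.
(* A member outside [U] contains [D] and some further [g] in [C]; by maximality of [D] each
   [above (g :: D)] is countable. *)
apply: (@sub_countable _ _ _ (U `|` \bigcup_(g in C `&` [set g | g \notin D]) above (g :: D))).
  apply: subset_card_le => t tD; have [tU|ntU] := pselect (U t); first by left.
  right; apply: contrapT => nt; apply: ntU; split=> // i.
  rewrite mem_filter => /andP[iD iS] Ci; apply: nt; exists i => //.
  by case: tD => tk tD; split=> // j; rewrite inE => /orP[/eqP->|/tD].
apply: countableU => //; apply: bigcup_countable => [|g [_ /= gD]].
  by apply: sub_countable cC; apply: subset_card_le => g [].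
apply: contrapT => cg.
have := maxd d.+1; rewrite ltnn => /(_ _)/negP; case; last by [].
by apply/asboolP; exists (g :: D); rewrite /= gD uD sD.
Qed.

End Spread.

(** A whole spread family of partners is asked for, not just one, so that the choice can be repeated
    inside it; the copies of l2 are built in this way. *)
Definition generic (I : choiceType) (E : I -> I -> Prop) :=
  forall (T : Type) (S : T -> seq I) (Z : set T), (forall t, uniq (S t)) ->
  spread S Z -> forall b : bool, exists2 s, Z s &
    spread S (Z `&` [set t |
      forall i j, i \in S s -> j \in S t -> i <> j /\ (E i j <-> b)]).

(** * Existence of a generic graph *)

Section GenericGraph.
Context {R : realType} {I : choiceType} (lt : I -> I -> Prop).
Hypothesis wI : omega1_order [set: I] lt.

Lemma countable_bounded (C : set I) : countable C -> exists d, forall i, C i -> lt i d.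
Proof.
have [cI _ _ _ _] := wI; move=> cC; apply: contrapT => no; apply: cI.
apply: (@sub_countable _ _ _ (\bigcup_(i in C) [set b | ~ lt i b])).
  apply: subset_card_le => d _; apply: contrapT => nd; apply: no; exists d => i Ci.
  by apply: contrapT => nid; apply: nd; exists i.
by apply: bigcup_countable => // i _; exact: countable_initial wI i.
Qed.

(** An edge is the colour [c] of the pair in increasing order. Disjoint members of [Z] of one size
    form a sequence [a]; by [coloring], each member avoiding a countable set has all colours [b]
    with some [a n], and the pigeonhole makes [n] the same for a spread family. *)
Lemma generic_graph (A : set R) : ~ meager A -> card_omega1 A ->
  exists2 E : I -> I -> Prop, (forall i j, E i j -> E j i) & generic E.
Proof.
move=> mA [ltA wA]; have [c cP] := coloring wI mA wA.
have [_ [irr trans] _ _ _] := wI.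
exists (fun i j => (lt i j /\ c i j) \/ (lt j i /\ c j i)).
  by move=> i j [|]; [right|left].
move=> T S Z uS sZ b.
have [k sZk] := spread_pigeonhole (fun t => size (S t)) sZ.
set Zk := Z `&` _ in sZk.
have /choice[next nextP] (used : seq I) : exists t, Zk t /\
    {in S t, forall i, i \notin used}.
  have := spread_avoiding (finite_set_countable (finite_seq used)) sZk.
  by move=> /spread_nonempty[t [Zt tu]]; exists t; split=> // i /tu /negP.
pose used := fix used n := if n is m.+1 then used m ++ S (next (used m)) else [::].
pose a n := S (next (used n)).
have usedP m n : (m < n)%N -> {subset a m <= used n}.
  elim: n => // n IH; rewrite ltnS leq_eqVlt => /orP[/eqP->|/IH mn] i im /=.
    by rewrite mem_cat im orbT.
  by rewrite mem_cat mn.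
have disj_a m n i : i \in a m -> i \in a n -> m = n.
  have lt_disj p q : (p < q)%N -> i \in a p -> i \in a q -> False.
    move=> pq /(usedP _ _ pq) iu iq.
    by have := (nextP (used q)).2 i iq; rewrite iu.
  by move=> im in_; have [mn|nm|//] := ltngtP m n; [case: (lt_disj m n)|case: (lt_disj n m)].
have [d dP] : exists d, forall i, (\bigcup_n [set` a n]) i -> lt i d.
  apply: countable_bounded; apply: bigcup_countable => // n _.
  exact: finite_set_countable.
have [||G cG GP] := cP k d a _ disj_a.
- by move=> n; case: (nextP (used n)) => -[].
- by move=> n i ian; apply: dP; exists n.
have /choice[lab labP] t : exists n, (Zk `&` avoiding S G) t ->
    {in a n, forall i, {in S t, forall j, lt i j /\ (c i j <-> b)}}.
  have [[[_ kt] tG]|nt] := pselect ((Zk `&` avoiding S G) t); last by exists 0%N.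
  by have [n nP] := GP (S t) (uS t) kt tG b; exists n.
have [n sn] := spread_pigeonhole lab (spread_avoiding cG sZk).
exists (next (used n)); first by have [[]] := nextP (used n).
apply: spread_sub sn => t [tG /= labt]; split; first by case: tG => -[].
move=> i j ia jt; have [lij cij] := labP t tG i (ltac:(by rewrite labt)) j jt.
split.
  by move=> ij; apply: (irr i) => //; rewrite {2}ij.
rewrite -cij; split; last by left.
case=> [[]//|[lji _]]; case: (irr i) => //.
exact: trans lij lji.
Qed.

End GenericGraph.

(** * Equilateral and separated sets *)

Lemma real_label (R : realType) (e : R) : 0 < e ->
  exists lab : R -> nat, forall a b, lab a = lab b -> `|a - b| <= e.
Proof.
move=> e0; exists (fun a => pickle (Num.floor (a / e))) => a b.
move=> /(pcan_inj pickleK) ab.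
have := floor_itv (a / e); have := floor_itv (b / e); rewrite ab !intrD1.
move: (_%:~R) => m /andP[b1 b2] /andP[a1 a2].
have -> : a - b = (a / e - b / e) * e by rewrite mulrBl !divfK ?gt_eqF.
rewrite normrM (gtr0_norm e0) ler_piMl ?(ltW e0)// ler_norml.
by apply/andP; split; lra.
Qed.

Lemma ler_sqr_nneg (R : realType) (a b : R) : 0 <= a -> a <= b -> a ^+ 2 <= b ^+ 2.
Proof. by move=> a0 ab; nra. Qed.

Section NormGeometry.
Context {R : realType} {I : choiceType} (E : I -> I -> Prop).
Implicit Types (f g : I -> R) (C : set I).

Lemma vanishing_tail f (x : seq I) (e : R) : vanishing E f -> 0 < e ->
  exists s, [/\ uniq s, {subset x <= s} & cnorm E (restr (~` [set` s]) f) <= e].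
Proof.
move=> vf e0; have [s0 h] := vf _ e0; exists (undup (x ++ s0)).
split; [exact: undup_uniq|by move=> i ix; rewrite mem_undup mem_cat ix|].
apply: cnorm_le => s cs; rewrite euc_restr; apply: h; first exact: clique_filter.
move=> i; rewrite mem_filter => /andP[/asboolP/= + _]; apply: contra_notN => i0.
by rewrite mem_undup mem_cat i0 orbT.
Qed.

Lemma cnorm_finite_le f (s : seq I) (d : R) : 0 <= d ->
  (forall i, i \notin s -> f i = 0) -> (forall i, i \in s -> `|f i| <= d) ->
  cnorm E f <= (size s)%:R * d.
Proof.
move=> d0 f0 fd; apply: cnorm_le => t [ut _].
apply: le_trans (euc_le_sum f t) _.
apply: le_trans (_ : \sum_(i <- s) `|f i| <= _); last first.
  rewrite mulr_natl -iter_addr_0 -count_predT -big_const_seq.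
  by rewrite big_seq [leRHS]big_seq; apply: ler_sum => i /fd.
rewrite (bigID (mem s)) /= [X in _ + X]big1 ?addr0 => [|i /f0->]; last by rewrite normr0.
rewrite -big_filter; apply: ler_sum_subset => // [|i]; first exact: filter_uniq.
by rewrite mem_filter => /andP[].
Qed.

(* A label records a finite set carrying almost all of f on C, together with
   integer approximations of the values of f there. *)
Lemma separating_label C (e : R) : countable C -> 0 < e ->
  exists lab : (I -> R) -> nat, forall f g, vanishing E f -> vanishing E g ->
    lab f = lab g -> cnorm E (restr C (f - g)) <= e.
Proof.
move=> /countable_injP[io ioinj] e0; have e40 : 0 < e / 4 by rewrite divr_gt0.
have /choice[S SP] f : exists s : seq I, vanishing E f ->
    {subset s <= C} /\ cnorm E (restr (C `\` [set` s]) f) <= e / 4.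
  have [vf|] := pselect (vanishing E f); last by exists [::].
  have [s [_ _ sP]] := vanishing_tail [::] vf e40.
  exists [seq i <- s | i \in C] => _; split=> [i|]; first by rewrite mem_filter => /andP[].
  apply: le_trans sP; apply: cnorm_restr_le => // i [Ci] /=.
  by rewrite mem_filter => /negP; rewrite negb_and mem_set//= => /negP.
(* The precision depends on the size of the finite set, so that the errors on it sum to at most
   [e / 2]; the two tails take [e / 4] each. *)
pose M (n : nat) : R := e / 2 / n.+1%:R.
have M0 n : 0 < M n by rewrite !divr_gt0.
have [rl rlP] := choice (fun n => real_label (M0 n)).
pose lab f := pickle (map io (S f), [seq rl (size (S f)) (f i) | i <- S f]).
exists lab => f g vf vg /(pcan_inj pickleK)[Sfg lfg].
have [CSf tf] := SP f vf; have [CSg tg] := SP g vg.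
have SE : S f = S g.
  by apply: (inj_in_map ioinj) => //; apply/allP => i; [move/CSf|move/CSg].
rewrite -SE in lfg tg.
have -> : restr C (f - g) = restr [set` S f] (f - g) +
    (restr (C `\` [set` S f]) f - restr (C `\` [set` S f]) g).
  rewrite -restrB; apply/funext => i; rewrite !fctE.
  have [iS|iS] := pselect (i \in S f).
    rewrite (@restrT _ _ [set` S f])// (@restrF _ _ (C `\` _)) ?addr0; last by case.
    by rewrite restrT//; apply/set_mem/CSf.
  rewrite (@restrF _ _ [set` S f])// add0r.
  have [Ci|nCi] := pselect (C i); first by rewrite !restrT.
  by rewrite !restrF// => -[].
have vr h D : vanishing E h -> vanishing E (restr D h) by exact: vanishing_restr.
apply: le_trans (cnormD _ _) _.
- by apply: vr; exact: vanishingB.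
- by apply: vanishingB; exact: vr.
have -> : e = e / 2 + (e / 4 + e / 4) by field.
apply: lerD; last by apply: le_trans (cnormB _ _) _; [exact: vr|exact: vr|exact: lerD].
apply: le_trans (_ : (size (S f))%:R * M (size (S f)) <= _); last first.
  rewrite /M mulrCA ler_piMr ?divr_ge0 ?(ltW e0)//.
  by rewrite ler_pdivrMr// mul1r ler_nat.
apply: cnorm_finite_le; first exact: ltW.
  by move=> i iS; rewrite restrF//; exact/negP.
move=> i iS; rewrite restrT// !fctE; apply: rlP.
move: lfg => /eq_in_map; exact.
Qed.

Lemma sqr_euc_disjoint f g s : (forall i, f i = 0 \/ g i = 0) ->
  euc (f + g) s ^+ 2 = euc f s ^+ 2 + euc g s ^+ 2.
Proof.
move=> fg; rewrite !sqr_euc -big_split; apply: eq_bigr => i _; rewrite !fctE.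
by case: (fg i) => ->; rewrite ?add0r ?addr0 expr0n /= ?add0r ?addr0.
Qed.

Lemma cnorm_disjoint f g : vanishing E f -> vanishing E g ->
  (forall i, f i = 0 \/ g i = 0) ->
  cnorm E (f + g) ^+ 2 <= cnorm E f ^+ 2 + cnorm E g ^+ 2.
Proof.
move=> vf vg fg; rewrite -[leRHS]sqr_sqrtr ?addr_ge0 ?sqr_ge0//.
have f0 := cnorm_ge0 vf; have g0 := cnorm_ge0 vg.
rewrite lerXn2r ?nnegrE ?sqrtr_ge0//; first by apply: cnorm_ge0; exact: vanishingD.
apply: cnorm_le => s cs; apply: ler_sqrt_sqr; first exact: sqrtr_ge0.
rewrite [leRHS]sqr_sqrtr ?addr_ge0 ?sqr_ge0// sqr_euc_disjoint//.
by rewrite lerD// lerXn2r ?nnegrE ?euc_ge0// euc_le_cnorm.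
Qed.

(** A clique in the support of [f] followed by one in the support of [g] is again a clique, so the
    squared sums add up. *)
Lemma cnorm_full f g : vanishing E f -> vanishing E g ->
  (forall i j, E i j -> E j i) ->
  (forall i j, f i <> 0 -> g j <> 0 -> i <> j /\ E i j) ->
  cnorm E f ^+ 2 + cnorm E g ^+ 2 <= cnorm E (f + g) ^+ 2.
Proof.
move=> vf vg symE fgE; have vfg := vanishingD vf vg.
have disj i : f i = 0 \/ g i = 0.
  by apply: contrapT => /not_orP[fi gi]; case: (fgE i i fi gi).
set M := cnorm E (f + g); have M0 : 0 <= M by exact: cnorm_ge0.
have both s t : clique E s -> clique E t -> euc f s ^+ 2 + euc g t ^+ 2 <= M ^+ 2.
  move=> cs ct.
  pose s' := [seq i <- s | f i != 0]; pose t' := [seq i <- t | g i != 0].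
  have s'P i : i \in s' -> f i <> 0 by rewrite mem_filter => /andP[/eqP].
  have t'P i : i \in t' -> g i <> 0 by rewrite mem_filter => /andP[/eqP].
  have [us' Es'] : clique E s' by exact: clique_filter.
  have [ut' Et'] : clique E t' by exact: clique_filter.
  have cst : clique E (s' ++ t').
    split.
      rewrite cat_uniq us' ut' andbT; apply/hasPn => i it; apply/negP => is_.
      by case: (fgE i i (s'P _ is_) (t'P _ it)).
    move=> i j; rewrite !mem_cat => /orP[is_|it] /orP[js|jt] ij; try by auto.
    - by case: (fgE i j (s'P _ is_) (t'P _ jt)).
    - by apply: symE; case: (fgE j i (s'P _ js) (t'P _ it)).
  have -> : euc f s ^+ 2 + euc g t ^+ 2 = euc (f + g) (s' ++ t') ^+ 2.
    rewrite !sqr_euc big_cat /= !big_filter; congr (_ + _).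
      rewrite big_mkcond [RHS]big_mkcond; apply: eq_bigr => i _ /=; rewrite fctE.
      by case: eqP => [->|fi] /=; [rewrite expr0n|case: (disj i) => // ->; rewrite addr0].
    rewrite big_mkcond [RHS]big_mkcond; apply: eq_bigr => i _ /=; rewrite fctE.
    by case: eqP => [->|fi] /=; [rewrite expr0n|case: (disj i) => // ->; rewrite add0r].
  by rewrite lerXn2r ?nnegrE ?euc_ge0// euc_le_cnorm.
(* The two suprema are taken one after the other, first over [t] with [s] fixed, then over [s]. *)
have half s : clique E s -> euc f s ^+ 2 + cnorm E g ^+ 2 <= M ^+ 2.
  move=> cs; have sM : 0 <= M ^+ 2 - euc f s ^+ 2.
    by have := both s [::] cs (clique_nil E); rewrite euc_nil; lra.
  have : cnorm E g <= Num.sqrt (M ^+ 2 - euc f s ^+ 2).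
    apply: cnorm_le => t ct; apply: ler_sqrt_sqr; first exact: sqrtr_ge0.
    by rewrite [leRHS]sqr_sqrtr//; have := both s t cs ct; lra.
  move/(ler_sqr_nneg (cnorm_ge0 vg)).
  by rewrite [leRHS]sqr_sqrtr//; lra.
have sM : 0 <= M ^+ 2 - cnorm E g ^+ 2.
  by have := half [::] (clique_nil E); rewrite euc_nil; lra.
have : cnorm E f <= Num.sqrt (M ^+ 2 - cnorm E g ^+ 2).
  apply: cnorm_le => t ct; apply: ler_sqrt_sqr; first exact: sqrtr_ge0.
  by rewrite [leRHS]sqr_sqrtr//; have := half t ct; lra.
move/(ler_sqr_nneg (cnorm_ge0 vf)).
by rewrite [leRHS]sqr_sqrtr//; lra.
Qed.

(** A clique cannot meet both supports, so on it [f + g] has the squares of only one of the two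
    functions. *)
Lemma cnorm_empty f g (M : R) : vanishing E f -> vanishing E g ->
  (forall i j, f i <> 0 -> g j <> 0 -> i <> j /\ ~ E i j) ->
  cnorm E f <= M -> cnorm E g <= M -> cnorm E (f + g) <= M.
Proof.
move=> vf vg fgE fM gM; apply: cnorm_le => s cs.
have [fs|/existsNP[i /not_implyP[is_ fi]]] := pselect (forall i, i \in s -> f i = 0).
  apply: le_trans gM; rewrite (@eq_euc _ _ _ g) ?euc_le_cnorm// => i /fs fi.
  by rewrite fctE fi add0r.
apply: le_trans fM; rewrite (@eq_euc _ _ _ f) ?euc_le_cnorm// => j js.
rewrite fctE; suff -> : g j = 0 by rewrite addr0.
apply: contrapT => gj; have [ij nE] := fgE i j fi gj.
by apply: nE; case: cs => _; exact.
Qed.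

End NormGeometry.

(** * Comparison of two graphs and reduction to finite blocks *)

Section SubGraph.
Context {R : realType} {I : choiceType} (E E0 : I -> I -> Prop).
Hypothesis EE0 : forall i j, E i j -> E0 i j.
Implicit Type f : I -> R.

Lemma clique_sub s : clique E s -> clique E0 s.
Proof. by move=> [us Es]; split=> // i j si sj /(Es i j si sj)/EE0. Qed.

Lemma vanishing_subgraph f : vanishing E0 f -> vanishing E f.
Proof.
move=> vf e /vf[s0 h]; exists s0 => s /clique_sub; exact: h.
Qed.

Lemma cnorm_subgraph f : vanishing E0 f -> cnorm E f <= cnorm E0 f.
Proof. by move=> vf; apply: cnorm_le => s /clique_sub; exact: euc_le_cnorm. Qed.

(** [B t] is a finite set carrying almost all of [F t], minus the common root [D]. Pigeonholes fix
    up to [e] the values on [D] and both norms of [u t]. The error [3 * e] comes from [D] and the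
    two tails. The list [x t] prescribes coordinates that the blocks must keep. *)
Lemma blocks T (F : T -> I -> R) (x : T -> seq I) (Z : set T) (e : R) :
  0 < e -> ~ countable Z -> (forall t, vanishing E0 (F t)) ->
  exists (D : seq I) (B : T -> seq I) (Z' : set T),
    let u t := restr [set` B t] (F t) in
  [/\ Z' `<=` Z, forall t, uniq (B t), spread B Z',
    forall t i, Z' t -> i \in x t -> i \notin D -> i \in B t
  & forall s t, Z' s -> Z' t ->
      [/\ cnorm E0 (F s - F t - (u s - u t)) <= 3 * e,
          `|cnorm E0 (u s) - cnorm E0 (u t)| <= e &
          `|cnorm E (u s) - cnorm E (u t)| <= e]].
Proof.
move=> e0 cZ vF.
have [S SP] := choice (fun t => vanishing_tail (x t) (vF t) e0).
have uS t : uniq (S t) by case: (SP t).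
have [D [Z0 Z0Z [DS sZ0]]] := root_lemma cZ uS.
pose B t := [seq i <- S t | i \notin D].
pose u t := restr [set` B t] (F t).
have [lab labP] := separating_label E0 (finite_set_countable (finite_seq D)) e0.
have [rl rlP] := real_label e0.
have [n1 sZ1] := spread_pigeonhole (fun t => lab (F t)) sZ0.
have [n2 sZ2] := spread_pigeonhole (fun t => rl (cnorm E0 (u t))) sZ1.
have [n3 sZ3] := spread_pigeonhole (fun t => rl (cnorm E (u t))) sZ2.
exists D, B, (Z0 `&` [set t | lab (F t) = n1] `&`
  [set t | rl (cnorm E0 (u t)) = n2] `&` [set t | rl (cnorm E (u t)) = n3]).
split; last 1 first.
- move=> s t [[[Zs ls] l1s] l2s] [[[Zt lt] l1t] l2t]; split; last 2 first.
  + by apply: rlP; rewrite l1s.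
  + by apply: rlP; rewrite l2s.
  have decomp r : Z0 r -> F r = restr [set` D] (F r) + u r + restr (~` [set` S r]) (F r).
    move=> Zr; apply/funext => i; rewrite /u !fctE.
    have [iD|iD] := pselect (i \in D).
      have iS := DS r Zr i iD.
      rewrite (@restrT _ _ [set` D])// (@restrF _ _ [set` B r]).
        by rewrite restrF ?addr0//= => /(_ iS).
      by rewrite /= mem_filter iD.
    rewrite (@restrF _ _ [set` D])// add0r; have [iS|iS] := pselect (i \in S r).
      rewrite (@restrT _ _ [set` B r]) ?restrF ?addr0 => [//|/(_ iS)//|/=].
      by rewrite mem_filter iS andbT; exact/negP.
    rewrite (@restrF _ _ [set` B r]) ?restrT ?add0r//=.
    by rewrite mem_filter => /andP[_].
  have -> : F s - F t - (u s - u t) = restr [set` D] (F s - F t) +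
      (restr (~` [set` S s]) (F s) - restr (~` [set` S t]) (F t)).
    rewrite [in LHS](decomp s)// [in LHS](decomp t)// restrB.
    by rewrite /u; ring.
  have vr C f : vanishing E0 f -> vanishing E0 (restr C f) by exact: vanishing_restr.
  apply: le_trans (cnormD _ _) _.
  + by apply: vr; exact: vanishingB.
  + by apply: vanishingB; exact: vr.
  have -> : 3 * e = e + (e + e) by ring.
  apply: lerD; first by apply: labP; rewrite // ls.
  apply: le_trans (cnormB (vr _ _ (vF s)) (vr _ _ (vF t))) _.
  by apply: lerD; [case: (SP s)|case: (SP t)].
- by move=> t [[[/Z0Z]]].
- by move=> t; exact: filter_uniq.
- exact: sZ3.
- by move=> t i _ ix iD; rewrite mem_filter iD; case: (SP t) => _ + _; apply.
Qed.

End SubGraph.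

Section GenericNorm.
Context {R : realType} {I : choiceType} (E : I -> I -> Prop).
Hypotheses (symE : forall i j, E i j -> E j i) (gE : generic E).

Lemma generic_pair T (B : T -> seq I) (Z : set T) (b : bool) :
  (forall t, uniq (B t)) -> spread B Z ->
  exists s t, [/\ Z s, Z t, s <> t &
    forall i j, i \in B s -> j \in B t -> i <> j /\ (E i j <-> b)].
Proof.
move=> uB sZ; have [s Zs sZs] := gE uB sZ b.
have [t [[Zt st] nts]] := spread_nonempty (spread_setD (countable1 s) sZs).
by exists s, t; split=> // /esym.
Qed.

Lemma cnorm_close (E1 : I -> I -> Prop) (f g : I -> R) (d : R) :
  vanishing E1 f -> vanishing E1 g -> cnorm E1 (f - g) <= d ->
  cnorm E1 f <= cnorm E1 g + d /\ cnorm E1 g <= cnorm E1 f + d.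
Proof.
move=> vf vg fgd; split.
  have {1}-> : f = g + (f - g) by rewrite addrC subrK.
  by apply: le_trans (cnormD vg (vanishingB vf vg)) _; rewrite lerD2l.
have {1}-> : g = f - (f - g) by rewrite opprB addrC subrK.
by apply: le_trans (cnormB vf (vanishingB vf vg)) _; rewrite lerD2l.
Qed.

Lemma cnorm_blocks_empty (F G : I -> R) (s t : seq I) (M : R) :
  vanishing E F -> vanishing E G ->
  (forall i j, i \in s -> j \in t -> i <> j /\ (E i j <-> false)) ->
  cnorm E (restr [set` s] F) <= M -> cnorm E (restr [set` t] G) <= M ->
  cnorm E (restr [set` s] F - restr [set` t] G) <= M.
Proof.
move=> vF vG st FM GM; apply: cnorm_empty => //; rewrite ?cnormN//.
- exact: vanishing_restr.
- by apply: vanishingN; exact: vanishing_restr.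
move=> i j Fi Gj.
have is_ : i \in s by apply: contrapT => is_; apply: Fi; rewrite restrF.
have jt : j \in t by apply: contrapT => jt; apply: Gj; rewrite fctE restrF ?oppr0.
by have [ij Eij] := st i j is_ jt; split=> // /Eij.
Qed.

End GenericNorm.

(** The lower bound of [cnorm_full] meets the Pythagorean upper bound of [cnorm_disjoint]. *)
Lemma cnorm_blocks_full (R : realType) (I : choiceType) (E : I -> I -> Prop)
  (F G : I -> R) (s t : seq I) :
  (forall i j, E i j -> E j i) -> vanishing E F -> vanishing E G ->
  (forall i j, i \in s -> j \in t -> i <> j /\ E i j) ->
  cnorm E (restr [set` s] F) ^+ 2 + cnorm E (restr [set` t] G) ^+ 2 =
  cnorm E (restr [set` s] F - restr [set` t] G) ^+ 2.
Proof.
move=> symE vF vG st; rewrite -(cnormN E (restr [set` t] G)).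
have vF' := vanishing_restr [set` s] vF.
have vG' := vanishingN (vanishing_restr [set` t] vG).
have stE i j : restr [set` s] F i <> 0 -> (- restr [set` t] G) j <> 0 ->
    i <> j /\ E i j.
  move=> Fi Gj; apply: st.
    by apply: contrapT => is_; apply: Fi; rewrite restrF.
  by apply: contrapT => jt; apply: Gj; rewrite fctE restrF ?oppr0.
apply/eqP; rewrite eq_le cnorm_full//= cnorm_disjoint// => i.
by apply: contrapT => /not_orP[Fi Gi]; case: (stE i i Fi Gi).
Qed.

(** * Uncountable sets in the clique space *)

Section NoSeparated.
Context {R : realType} {I : choiceType} (E : I -> I -> Prop).
Hypotheses (symE : forall i j, E i j -> E j i) (gE : generic E).

Lemma no_uncountable_separated (eps : R) (Y : set (cliqueSpace R E)) : 0 < eps ->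
  Y `<=` @unit_sphere R (cliqueSpace R E) -> ~ countable Y ->
  ~ delta_separated (1 + eps) Y.
Proof.
(* The total error [3 * eps / 8] stays below [eps]. *)
move=> eps0 Y1 cY sepY; have e0 : 0 < eps / 8 by rewrite divr_gt0.
have [D [B [Z [ZY uB sZ _ close]]]] := blocks E
  (fun=> [::]) e0 cY (@cfunP R I E).
have [s [t [Zs Zt st nE]]] := generic_pair gE false uB sZ.
have := sepY s t (ZY _ Zs) (ZY _ Zt) st; apply/negP; rewrite -ltNge normE cfunB.
have [c1 _ _] := close s t Zs Zt.
have vB r : vanishing E (restr [set` B r] (r : I -> R)).
  exact: vanishing_restr (@cfunP R I E r).
have [c2 _] := cnorm_close (vanishingB (@cfunP R I E s) (@cfunP R I E t))
  (vanishingB (vB s) (vB t)) c1.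
apply: le_lt_trans c2 _.
have B1 r : Z r -> cnorm E (restr [set` B r] (r : I -> R)) <= 1.
  by move=> /ZY/Y1 <-; exact: cnorm_restr (@cfunP R I E r).
have := cnorm_blocks_empty (@cfunP R I E s) (@cfunP R I E t) nE (B1 s Zs) (B1 t Zt).
lra.
Qed.

Lemma no_uncountable_equilateral (Y : set (cliqueSpace R E)) :
  ~ countable Y -> ~ equilateral Y.
Proof.
move=> cY [d d0 eqY]; pose e := d / 100; have e0 : 0 < e by rewrite divr_gt0.
have [D [B [Z [ZY uB sZ _ close]]]] := blocks E
  (fun=> [::]) e0 cY (@cfunP R I E).
pose u (r : cliqueSpace R E) := restr [set` B r] (r : I -> R).
have vu r : vanishing E (u r) by exact: vanishing_restr (@cfunP R I E r).
have dist s t : Z s -> Z t -> s <> t ->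
    d <= cnorm E (u s - u t) + 3 * e /\ cnorm E (u s - u t) <= d + 3 * e.
  move=> Zs Zt st; have [c _ _] := close s t Zs Zt.
  rewrite -(eqY s t (ZY _ Zs) (ZY _ Zt) st) normE cfunB.
  exact: cnorm_close (vanishingB (@cfunP R I E s) (@cfunP R I E t))
    (vanishingB (vu s) (vu t)) c.
have [s [t [Zs Zt st nE]]] := generic_pair gE false uB sZ.
have [s' [t' [Zs' Zt' st' fE]]] := generic_pair gE true uB sZ.
have [d1 _] := dist s t Zs Zt st; have [_ d2] := dist s' t' Zs' Zt' st'.
have near r : Z r -> cnorm E (u s) - e <= cnorm E (u r) <= cnorm E (u s) + e.
  by move=> Zr; have [_ _] := close r s Zr Zs; rewrite -/(u _) ler_distl.
have := cnorm_blocks_empty (@cfunP R I E s) (@cfunP R I E t) nE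
  (M := cnorm E (u s) + e) ltac:(by case/andP: (near s Zs))
  ltac:(by case/andP: (near t Zt)).
rewrite -/(u _) -/(u _) => up.
have /(cnorm_blocks_full symE (@cfunP R I E s') (@cfunP R I E t')) :
    forall i j, i \in B s' -> j \in B t' -> i <> j /\ E i j.
  by move=> i j i_ j_; have [? [_]] := fE i j i_ j_; split; auto.
rewrite -/(u _) -/(u _) => low.
have /andP[n1 _] := near s' Zs'; have /andP[n2 _] := near t' Zt'.
have de : d = 100 * e by rewrite /e; field.
have := cnorm_ge0 (vanishingB (vu s') (vu t')).
move: low d1 d2 up n1 n2; rewrite de.
move: (cnorm E (u s' - u t')) (cnorm E (u s - u t)) (cnorm E (u s'))
  (cnorm E (u t')) (cnorm E (u s)) => a' a p q v low d1 d2 up n1 n2 a'0.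
(* The pair without edges gives [100 e <= v + 4 e]. The fully joined pair then needs
   [2 (95 e)^2 <= (103 e)^2], which is false. *)
have v0 : 96 * e <= v by lra.
have h1 : (v - e) ^+ 2 <= p ^+ 2 by apply: ler_sqr_nneg => //; lra.
have h2 : (v - e) ^+ 2 <= q ^+ 2 by apply: ler_sqr_nneg => //; lra.
have h3 : a' ^+ 2 <= (103 * e) ^+ 2 by apply: ler_sqr_nneg => //; lra.
have h4 : (95 * e) ^+ 2 <= (v - e) ^+ 2 by apply: ler_sqr_nneg; lra.
have e2 : 0 < e ^+ 2 by rewrite exprn_gt0.
by lra.
Qed.

End NoSeparated.

(** * Square-summable functions as the complete graph case *)

Section SquareSummable.
Context {R : realType} {I : choiceType}.
Implicit Type f : I -> R.

Definition full (i j : I) := True.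

Lemma clique_full s : clique full s <-> uniq s.
Proof. by split=> [[]//|us]; split. Qed.

Lemma esum_sqr_le f (M : R) : (forall s, uniq s -> \sum_(i <- s) f i ^+ 2 <= M) ->
  (\esum_(i in [set: I]) (f i ^+ 2)%:E <= M%:E)%E.
Proof.
move=> h; apply: ge_ereal_sup => _ [F [finF _] <-].
rewrite fsbig_finite//= sumEFin lee_fin; exact: h.
Qed.

Lemma sum_sqr_le_esum f s : uniq s ->
  ((\sum_(i <- s) f i ^+ 2)%:E <= \esum_(i in [set: I]) (f i ^+ 2)%:E)%E.
Proof.
move=> us; rewrite -sumEFin; apply: ereal_sup_ubound; exists [set` s].
  by split=> //; exact: finite_seq.
by rewrite -fsbig_seq.
Qed.

Lemma l2_esum_fin f : l2 f -> (\esum_(i in [set: I]) (f i ^+ 2)%:E \is a fin_num)%E.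
Proof.
by move=> lf; rewrite ge0_fin_numE//; apply: esum_ge0 => i _; rewrite lee_fin sqr_ge0.
Qed.

Lemma l2_vanishing f : l2 f <-> vanishing full f.
Proof.
split=> [lf e e0|vf].
  have finf := l2_esum_fin lf.
  (* A finite set whose sum is within [e ^+ 2] of the total leaves less than [e ^+ 2] to any
     disjoint list. *)
  have [_ [F [finF _] <-]] := ub_ereal_sup_adherent (exprn_gt0 2 e0) finf.
  have [s Fs] := (finite_seqP F).1 finF; pose s0 := undup s.
  have us0 : uniq s0 := undup_uniq s.
  have -> : F = [set` s0] by rewrite Fs; apply/seteqP; split=> i /=; rewrite mem_undup.
  rewrite -/(esum _ _) -fsbig_seq//= sumEFin.
  move=> lt0; exists s0 => t /clique_full us ss0.
  apply: ler_sqrt_sqr; first exact: ltW.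
  have : uniq (t ++ s0).
    rewrite cat_uniq us us0 andbT; apply/hasPn => i is0; apply/negP => /ss0.
    by rewrite is0.
  move=> /(sum_sqr_le_esum f); rewrite -(fineK finf) in lt0 *.
  rewrite lee_fin big_cat /= -EFinB lte_fin in lt0 *.
  by rewrite sqr_euc => h; lra.
have [M hM] := vanishing_bounded vf.
apply: (@le_lt_trans _ _ (M ^+ 2)%:E); last exact: ltry.
apply: esum_sqr_le => s us; rewrite -sqr_euc; apply: ler_sqr_nneg; first exact: euc_ge0.
by apply: hM; exact/clique_full.
Qed.

Lemma l2normE f : l2 f -> l2norm f = cnorm full f.
Proof.
move=> lf; have vf := (l2_vanishing f).1 lf; have finf := l2_esum_fin lf.
apply/eqP; rewrite eq_le; apply/andP; split.
  apply: ler_sqrt_sqr; first exact: cnorm_ge0.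
  rewrite sqr_sqrtr; last first.
    by apply: fine_ge0; apply: esum_ge0 => i _; rewrite lee_fin sqr_ge0.
  rewrite -lee_fin fineK//; apply: esum_sqr_le => s us; rewrite -sqr_euc.
  apply: ler_sqr_nneg; first exact: euc_ge0.
  by apply: euc_le_cnorm => //; exact/clique_full.
apply: cnorm_le => s /clique_full us; apply: ler_wsqrtr.
by rewrite -lee_fin fineK// sum_sqr_le_esum.
Qed.

End SquareSummable.

(** * The equivalent norm on l2 *)

Section Renorming.
Context {R : realType} {I : choiceType} (E : I -> I -> Prop).
Hypotheses (symE : forall i j, E i j -> E j i) (gE : generic E).

Let vE (x : I -> R) : vanishing full x -> vanishing E x.
Proof. exact: vanishing_subgraph. Qed.

Let EF (x : I -> R) : vanishing full x -> cnorm E x <= cnorm full x.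
Proof. exact: cnorm_subgraph. Qed.

Definition renorm (x : I -> R) : R := cnorm full x + cnorm E x.

Lemma renorm_equivalent : equivalent_l2_norm renorm.
Proof.
split=> [x /l2_vanishing vx x0|a x /l2_vanishing vx|x y /l2_vanishing vx /l2_vanishing vy|].
- have n1 := cnorm_ge0 vx; have n2 := cnorm_ge0 (vE vx).
  by apply: (cnorm_eq0 vx); move: x0; rewrite /renorm; lra.
- rewrite /renorm -[fun i => _]/(a *: x) !cnormZ//; last exact: vE.
  by rewrite mulrDr.
- rewrite /renorm -[fun i => _]/(x + y).
  have := cnormD vx vy; have := cnormD (vE vx) (vE vy); lra.
- exists 1, 2; split=> // x lx; rewrite l2normE//; move/l2_vanishing in lx.
  have n2 := cnorm_ge0 (vE lx); have := EF lx.
  by rewrite /renorm; split; lra.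
Qed.

(** Otherwise all of [Y] lives on one countable set, where countably many labels separate points at
    distance [d]. The point of a coordinate bound is that, unlike separation in the l2 norm, it also
    bounds the norm of the generic graph from below. *)
Lemma uncountable_large_coordinates (Y : set (I -> R)) (d : R) : 0 < d ->
  (forall y, Y y -> vanishing full y) -> ~ countable Y ->
  (forall y y', Y y -> Y y' -> y <> y' -> d <= cnorm full (y - y')) ->
  exists2 m : R, 0 < m & ~ countable [set b | exists2 y, Y y & m <= `|y b|].
Proof.
move=> d0 vY cY sepY; apply: contrapT => no.
pose Z n := [set b | exists2 y, Y y & n.+1%:R^-1 <= `|y b|].
have cC : countable (\bigcup_n Z n).
  apply: bigcup_countable => // n _; apply: contrapT => cZ; apply: no.
  by exists n.+1%:R^-1; rewrite ?invr_gt0.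
have supp y i : Y y -> ~ (\bigcup_n Z n) i -> y i = 0.
  move=> Yy nC; apply: contrapT => yi; apply: nC.
  have : 0 < `|y i| by rewrite normr_gt0; exact/eqP.
  by move=> /ltr_add_invr[n]; rewrite add0r => /ltW ny; exists n => //; exists y.
have [lab labP] := separating_label full cC (divr_gt0 d0 (ltr0n R 2)).
have [n cn] := uncountable_pigeonhole lab cY.
have [y [Yy ly]] : Y `&` [set t | lab t = n] !=set0.
  by apply/set0P/eqP => Y0; apply: cn; rewrite Y0; exact: countable0.
have [y' [Yy' ly'] yy'] : exists2 y', (Y `&` [set t | lab t = n]) y' & y <> y'.
  apply: contrapT => all; apply: cn; apply: sub_countable (countable1 y).
  by apply: subset_card_le => y' Yy'; apply: contrapT => ne; apply: all; exists y' => // /esym.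
have := sepY y y' Yy Yy' yy'; apply/negP; rewrite -ltNge.
have -> : y - y' = restr (\bigcup_n Z n) (y - y').
  apply/funext => i; have [Ci|nCi] := pselect ((\bigcup_n Z n) i); first by rewrite restrT.
  by rewrite restrF// !fctE !supp// subrr.
apply: le_lt_trans (labP y y' (vY _ Yy) (vY _ Yy') _) _; first by rewrite ly ly'.
by lra.
Qed.

Lemma renorm_no_equilateral (Y : set (I -> R)) (d : R) : 0 < d ->
  Y `<=` @l2 R I -> ~ countable Y ->
  ~ (forall y y', Y y -> Y y' -> y <> y' -> renorm (fun i => y i - y' i) = d).
Proof.
move=> d0 lY cY eqY.
have vY y : Y y -> vanishing full y by move=> /lY /l2_vanishing.
have sepY y y' : Y y -> Y y' -> y <> y' -> d / 2 <= cnorm full (y - y').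
  move=> Yy Yy' /(eqY y y' Yy Yy'); rewrite /renorm -[fun i => _]/(y - y').
  by have := EF (vanishingB (vY y Yy) (vY y' Yy')); lra.
have [m m0 cZ] := uncountable_large_coordinates (divr_gt0 d0 (ltr0n R 2)) vY cY sepY.
set Z := [set b | _] in cZ.
(* The family is reindexed by its large coordinates: [F b] has a coordinate of size at least [m] at
   [b] itself. Keeping [b] in the block makes [m] a lower bound for [cnorm E (u b)]. *)
have /choice[F FP] (b : I) : exists y : I -> R,
    vanishing full y /\ (Z b -> Y y /\ m <= `|y b|).
  have [[y Yy my]|nZ] := pselect (Z b); first by exists y; split=> //; exact: vY.
  by exists 0; split=> //; exact: vanishing0.
have vF b : vanishing full (F b) by case: (FP b).
pose e := m / 100; have e0 : 0 < e by rewrite divr_gt0.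
have [D [B [Z' [Z'Z uB sZ' bB close]]]] := blocks E (fun b => [:: b]) e0 cZ vF.
have {}sZ := spread_setD (finite_set_countable (finite_seq D)) sZ'.
set Z1 := Z' `\` [set` D] in sZ.
pose u (b : I) := restr [set` B b] (F b).
have vu b : vanishing full (u b) by exact: vanishing_restr.
have large b : Z1 b -> m <= cnorm E (u b) /\ cnorm E (u b) <= cnorm full (u b).
  move=> [Z'b /negP bD]; split; last exact: EF.
  apply: le_trans (norm_le_cnorm b (vE (vu b))); rewrite /u restrT /=.
    by case: (FP b) => _ /(_ (Z'Z _ Z'b))[].
  by apply: bB; rewrite ?mem_head.
have dist s t : Z1 s -> Z1 t ->
    (forall i j, i \in B s -> j \in B t -> i <> j /\ full i j) ->
    d <= cnorm full (u s - u t) + cnorm E (u s - u t) + 6 * e /\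
    cnorm full (u s - u t) + cnorm E (u s - u t) <= d + 6 * e.
  move=> Zs Zt st; have [Z's _] := Zs; have [Z't _] := Zt.
  have [c _ _] := close s t Z's Z't.
  have vFst := vanishingB (vF s) (vF t); have vust := vanishingB (vu s) (vu t).
  have [f1 f2] := cnorm_close vFst vust c.
  have [g1 g2] := cnorm_close (vE vFst) (vE vust) (le_trans (EF (vanishingB vFst vust)) c).
  have [Ys _] := (FP s).2 (Z'Z _ Z's); have [Yt _] := (FP t).2 (Z'Z _ Z't).
  have := eqY (F s) (F t) Ys Yt; rewrite /renorm -[fun i => _]/(F s - F t).
  (* The map [F] may repeat values. If [F s = F t], then [u s - u t] has l2 norm at most [3 e],
     while by Pythagoras it is at least that of [u s], hence at least [100 e]. *)
  suff FF : F s <> F t by move=> /(_ FF); lra.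
  move=> FF; move: f2; rewrite FF subrr.
  have -> : cnorm full (0 : I -> R) = 0.
    by rewrite -(scale0r (F s)) cnormZ// normr0 mul0r.
  have := cnorm_blocks_full (fun i j (h : full i j) => h : full j i)
    (vF s) (vF t) st.
  rewrite -/(u s) -/(u t).
  have [ms us] := large s Zs.
  have := sqr_ge0 (cnorm full (u t)); have := cnorm_ge0 vust.
  have me : m = 100 * e by rewrite /e; field.
  have : (100 * e) ^+ 2 <= cnorm full (u s) ^+ 2 by apply: ler_sqr_nneg; lra.
  move: (cnorm full (u s - u t)) => a h1 a0 t0 h2 h3.
  have : a ^+ 2 <= (3 * e) ^+ 2 by apply: ler_sqr_nneg; lra.
  have : 0 < e ^+ 2 by rewrite exprn_gt0.
  by lra.
have [s [t [Zs Zt st nE]]] := generic_pair gE false uB sZ.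
have [s' [t' [Zs' Zt' st' fE]]] := generic_pair gE true uB sZ.
have F1 i j : i \in B s -> j \in B t -> i <> j /\ full i j.
  by move=> i_ j_; have [] := nE i j i_ j_.
have F2 i j : i \in B s' -> j \in B t' -> i <> j /\ full i j.
  by move=> i_ j_; have [] := fE i j i_ j_.
have E2 i j : i \in B s' -> j \in B t' -> i <> j /\ E i j.
  by move=> i_ j_; have [? [_]] := fE i j i_ j_; split; auto.
have [d1 _] := dist s t Zs Zt F1; have [_ d2] := dist s' t' Zs' Zt' F2.
have near r q : Z1 r -> Z1 q -> cnorm full (u r) <= cnorm full (u q) + e /\
    cnorm E (u q) - e <= cnorm E (u r) <= cnorm E (u q) + e.
  move=> [Zr _] [Zq _]; have [_ c1 c2] := close r q Zr Zq.
  by move: c1 c2; rewrite -/(u r) -/(u q) !ler_distl => /andP[_ ->].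
have := cnorm_blocks_empty (vE (vF s)) (vE (vF t)) nE
  (M := cnorm E (u s) + e) ltac:(by case/andP: (near s s Zs Zs).2)
  ltac:(by case/andP: (near t s Zt Zs).2).
rewrite -/(u s) -/(u t) => up.
have := cnorm_blocks_full symE (vE (vF s')) (vE (vF t')) E2.
rewrite -/(u s') -/(u t') => low.
have := cnorm_blocks_full (fun i j (h : full i j) => h : full j i) (vF s) (vF t) F1.
rewrite -/(u s) -/(u t) => l1.
have := cnorm_blocks_full (fun i j (h : full i j) => h : full j i) (vF s') (vF t') F2.
rewrite -/(u s') -/(u t') => l2.
have [ns _] := near s s' Zs Zs'; have [nt _] := near t t' Zt Zt'.
have [_ /andP[ns' _]] := near s' s Zs' Zs; have [_ /andP[nt' _]] := near t' s Zt' Zs.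
have [ms _] := large s Zs.
have a0 := cnorm_ge0 (vanishingB (vu s) (vu t)).
have a'0 := cnorm_ge0 (vanishingB (vu s') (vu t')).
have b'0 := cnorm_ge0 (vE (vanishingB (vu s') (vu t'))).
have ls'0 := cnorm_ge0 (vu s'); have lt'0 := cnorm_ge0 (vu t').
have ls0 := cnorm_ge0 (vu s); have lt0 := cnorm_ge0 (vu t).
have me : m = 100 * e by rewrite /e; field.
move: d1 d2 up low l1 l2 ns nt ns' nt' ms a0 a'0 b'0 ls'0 lt'0 ls0 lt0; rewrite me.
clearbody e.
move: (cnorm full (u s - u t)) (cnorm full (u s' - u t')) (cnorm E (u s - u t))
  (cnorm E (u s' - u t')) (cnorm full (u s)) (cnorm full (u t))
  (cnorm full (u s')) (cnorm full (u t')) (cnorm E (u s)) (cnorm E (u s'))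
  (cnorm E (u t')).
move=> a a' b b' p q p' q' v w w' d1 d2 up low l1 l2 pp' qq' vw vw' v0.
move=> a0 a'0 b'0 p'0 q'0 p0 q0.
have p'a : p' <= a' by apply: ler_sqrt_sqr => //; have := sqr_ge0 q'; lra.
have q'a : q' <= a' by apply: ler_sqrt_sqr => //; have := sqr_ge0 p'; lra.
(* By Pythagoras the l2 distances of the two pairs depend only on the block norms, which agree up to
   [e]. *)
have aa' : a <= a' + 2 * e.
  apply: ler_sqrt_sqr; first by lra.
  have := ler_sqr_nneg p0 pp'; have := ler_sqr_nneg q0 qq'.
  have : e * p' <= e * a' by rewrite ler_wpM2l// ltW.
  have : e * q' <= e * a' by rewrite ler_wpM2l// ltW.
  have := sqr_ge0 e; lra.
(* Subtracting the nearly equal l2 parts bounds the fully joined distance by the unjoined one. But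
   [b'] is at least [sqrt 2] times [v - e], and [2 (v - e)^2 <= (v + 15 e)^2] fails for
   [v >= 100 e]. *)
have h : b' <= v + 15 * e by lra.
have h1 : (v - e) ^+ 2 <= w ^+ 2 by apply: ler_sqr_nneg => //; lra.
have h2 : (v - e) ^+ 2 <= w' ^+ 2 by apply: ler_sqr_nneg => //; lra.
have h3 := ler_sqr_nneg b'0 h.
have h4 : (100 * e) ^+ 2 <= v ^+ 2 by apply: ler_sqr_nneg; lra.
have h5 : 100 * e * e <= v * e by rewrite ler_wpM2r// ltW.
have h6 : 100 * e * v <= v * v by rewrite ler_wpM2r//; lra.
have e2 : 0 < e ^+ 2 by rewrite exprn_gt0.
by lra.
Qed.

End Renorming.

(** * Hilbert generation and nonseparability *)

Section HilbertGenerated.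
Context {R : realType} {I : choiceType}.

Lemma sqr_cnorm_approx (f : I -> R) (e : R) : vanishing full f -> 0 < e ->
  exists s0 : seq I, forall s, uniq s -> {subset s0 <= s} ->
    `|cnorm full f ^+ 2 - euc f s ^+ 2| <= e.
Proof.
move=> vf e0; have n0 := cnorm_ge0 vf.
have [s0 us0 hs0] : exists2 s0, uniq s0 & cnorm full f ^+ 2 - e <= euc f s0 ^+ 2.
  apply: contrapT => no.
  have lt_ s : uniq s -> euc f s ^+ 2 < cnorm full f ^+ 2 - e.
    by move=> us; rewrite ltNge; apply/negP => h; apply: no; exists s.
  have p0 : 0 < cnorm full f ^+ 2 - e by apply: le_lt_trans (lt_ [::] isT); exact: sqr_ge0.
  have : cnorm full f <= Num.sqrt (cnorm full f ^+ 2 - e).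
    apply: cnorm_le => s /clique_full us; apply: ler_sqrt_sqr; first exact: sqrtr_ge0.
    by rewrite [leRHS]sqr_sqrtr ltW// lt_.
  by move/(ler_sqr_nneg n0); rewrite [leRHS]sqr_sqrtr ?(ltW p0)//; lra.
exists s0 => s us ss; rewrite ler_norml; apply/andP; split.
  have := ler_sqr_nneg (euc_ge0 f s) (euc_le_cnorm vf ((clique_full s).2 us)); lra.
have : euc f s0 ^+ 2 <= euc f s ^+ 2.
  by rewrite !sqr_euc; apply: ler_sum_subset => // i; exact: sqr_ge0.
by lra.
Qed.

(** Squared norms are approximated simultaneously by sums over one finite set, so a linear relation
    between squares passes from coordinates to norms. *)
Lemma quadratic_identity n (c : 'I_n -> R) (f : 'I_n -> I -> R) :
  (forall j, vanishing full (f j)) ->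
  (forall i, \sum_(j < n) c j * f j i ^+ 2 = 0) ->
  \sum_(j < n) c j * cnorm full (f j) ^+ 2 = 0.
Proof.
move=> vf cf; apply/eqP; rewrite -normr_le0; apply/ler_addgt0Pl => e e0; rewrite addr0.
pose K : R := 1 + \sum_(j < n) `|c j|.
have K0 : 0 < K by rewrite ltr_wpDr// sumr_ge0.
have [s0 s0P] := choice (fun j => sqr_cnorm_approx (vf j) (divr_gt0 e0 K0)).
pose s := undup (flatten [seq s0 j | j <- enum 'I_n]).
have us : uniq s by exact: undup_uniq.
have s0s j : {subset s0 j <= s}.
  move=> i ij; rewrite mem_undup; apply/flattenP; exists (s0 j) => //.
  by apply/mapP; exists j; rewrite ?mem_enum.
have -> : \sum_(j < n) c j * cnorm full (f j) ^+ 2 =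
    \sum_(j < n) c j * (cnorm full (f j) ^+ 2 - euc (f j) s ^+ 2).
  under [RHS]eq_bigr do rewrite mulrBr.
  rewrite sumrB [X in _ - X](_ : _ = 0) ?subr0//.
  under eq_bigr do rewrite sqr_euc mulr_sumr.
  by rewrite exchange_big big1// => i _; exact: cf.
apply: le_trans (ler_norm_sum _ _ _) _.
apply: le_trans (_ : \sum_(j < n) `|c j| * (e / K) <= _).
  by apply: ler_sum => j _; rewrite normrM ler_wpM2l// s0P.
rewrite -mulr_suml mulrCA ler_piMr ?(ltW e0)// ler_pdivrMr// mul1r.
by rewrite /K lerDr.
Qed.

Lemma full_hilbert : hilbert_space (cliqueSpace R (@full I)).
Proof.
pose ip (x y : cliqueSpace R (@full I)) : R :=
  (`|x + y| ^+ 2 - `|x| ^+ 2 - `|y| ^+ 2) / 2.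
exists ip; split=> [x y|a x y z|x].
- by rewrite /ip (addrC y x); lra.
(* After polarization, linearity of [ip] is a linear relation between the squared norms of these
   seven vectors. *)
- pose c := [:: 1; -1; - a; a; a; -1; 1 : R].
  pose f : seq (cliqueSpace R (@full I)) :=
    [:: a *: x + y + z; a *: x + y; x + z; x; z; y + z; y].
  have id i : \sum_(j < 7) c`_j * (f`_j : I -> R) i ^+ 2 = 0.
    by rewrite !big_ord_recl big_ord0 /= !fctE /GRing.scale /=; ring.
  have : \sum_(j < 7) c`_j * `|f`_j| ^+ 2 = 0.
    exact: (quadratic_identity (fun j : 'I_7 => cfunP f`_j) id).
  have lin (q1 q2 q3 q4 q5 q6 q7 : R) :
      1 * q1 + (-1 * q2 + (- a * q3 + (a * q4 + (a * q5 + (-1 * q6 +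
      (1 * q7 + 0)))))) = 0 ->
      (q1 - q2 - q5) / 2 = a * ((q3 - q4 - q5) / 2) + (q6 - q7 - q5) / 2 by lra.
  rewrite !big_ord_recl big_ord0; exact: lin.
- rewrite /ip (_ : x + x = 2 *: x); last by rewrite scaler_nat.
  by rewrite normrZ ger0_norm//; lra.
Qed.

Variable E : I -> I -> Prop.

(** The operator is the inclusion of l2: it is contractive since cliques are duplicate-free lists,
    and its range contains the dense finite truncations. *)
Lemma clique_space_hilbert_generated : hilbert_generated (cliqueSpace R E).
Proof.
have vE (x : cliqueSpace R (@full I)) : vanishing E x.
  by apply: vanishing_subgraph (cfunP x).
pose T (x : cliqueSpace R (@full I)) : cliqueSpace R E :=
  CliqueSpace ((vanishing_predP E x).2 (vE x)).
exists (cliqueSpace R (@full I)), T; split; first exact: full_hilbert.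
  split=> [a x y|]; first exact: val_inj.
  exists 1 => x; rewrite mul1r; apply: cnorm_subgraph (cfunP x) => //.
apply/seteqP; split=> // x _ U /nbhs_ballP[e /= e0 eU].
have [s [_ _ hs]] := vanishing_tail [::] (cfunP x) (divr_gt0 e0 (ltr0n R 2)).
have vr : vanishing full (restr [set` s] x).
  by apply: (@vanishing_finite _ _ _ s) => i /negP is_; rewrite restrF.
pose y := CliqueSpace ((vanishing_predP full _).2 vr).
exists (T y); split; first by exists y.
apply: eU; rewrite -ball_normE /ball_ /= normE cfunB.
have -> : (x : I -> R) - T y = restr (~` [set` s]) x.
  by rewrite {1}(restrC [set` s] x) addrAC subrr add0r.
by apply: le_lt_trans hs _; lra.
Qed.

(** The supports of countably many vectors have a countable union; the indicator of a vertex outside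
    it is at distance at least 1 from all of them. *)
Lemma clique_space_nonseparable : ~ countable [set: I] ->
  ~ separable_space (cliqueSpace R E).
Proof.
move=> cI [D cD [_ dD]]; apply: cI.
apply: (@sub_countable _ _ _ (\bigcup_(x in D) [set i | (x : cliqueSpace R E) i <> 0])).
  apply: subset_card_le => i _; apply: contrapT => ni.
  have vi : vanishing E (restr [set` [:: i]] (fun=> 1 : R)).
    by apply: (@vanishing_finite _ _ _ [:: i]) => j /negP ji; rewrite restrF.
  pose e := CliqueSpace ((vanishing_predP E _).2 vi).
  have [x [Dx]] := dD e Logic.I _ (nbhsx_ballx e 1 ltr01).
  rewrite -ball_normE /ball_ /=; apply/negP; rewrite -leNgt.
  apply: le_trans (eval_le_norm (e - x) i); rewrite cfunB fctE /= restrT ?mem_head//=;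
    last exact: mem_head.
  rewrite fctE (_ : (x : I -> R) i = 0) ?oppr0 ?addr0 ?normr1//.
  by apply: contrapT => xi; apply: ni; exists x.
exact: (bigcup_countable cD (fun x _ => vanishing_countable (cfunP x))).
Qed.

End HilbertGenerated.

(** * Copies of l2 in nonseparable subspaces *)

Lemma ltn_bigmax (s : seq nat) i : i \in s -> (i < \max_(j <- s) j.+1)%N.
Proof.
elim: s => // j s IH; rewrite inE big_cons leq_max => /orP[/eqP->|/IH->].
  by rewrite leqnn.
by rewrite orbT.
Qed.

Section L2Embedding.
Context {R : realType} (X : completeNormedModType R).

(** The upper bound on all segments makes the series Cauchy for square-summable coefficients; both
    bounds then pass to the limit. *)
Lemma l2_embedding (S : set X) (z : nat -> X) : closed_subspace S ->
  (forall n, S (z n)) ->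
  (forall (a : nat -> R) N M,
    euc a (index_iota N M) <= 8 * `|\sum_(N <= n < M) a n *: z n| /\
    `|\sum_(N <= n < M) a n *: z n| <= 3 * euc a (index_iota N M)) ->
  contains_l2 S.
Proof.
move=> [[S0 SD] cS] Sz bnd.
pose u (a : nat -> R) := series (fun n => a n *: z n).
have cu a : l2 a -> cvg (u a @ \oo).
  move=> /l2_vanishing va; apply: cauchy_cvg; apply/cauchy_seriesP => e e0.
  have [s hs] := va _ (divr_gt0 e0 (ltr0n R 4)).
  exists ([set n | (\max_(i <- s) i.+1 <= n)%N], setT) => /=.
    by split; [exists (\max_(i <- s) i.+1)|exact: filterT].
  move=> [N M] [/= sN _]; apply: le_lt_trans (bnd a N M).2 _.
  have : euc a (index_iota N M) <= e / 4.
    apply: hs => [|i]; first by apply/clique_full; exact: iota_uniq.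
    rewrite mem_index_iota => /andP[Ni _]; apply/negP => is_.
    have : (i.+1 <= \max_(i <- s) i.+1)%N by exact: ltn_bigmax.
    by move=> /leq_trans /(_ sN); rewrite ltnNge Ni.
  by move: (euc _ _) => q; lra.
have Su a n : S (u a n).
  rewrite /u /series /=; elim/big_ind: _ => [//|x y Sx Sy|i _].
    by rewrite -[x]scale1r; exact: SD.
  by rewrite -[_ *: _]addr0; exact: SD.
pose T a := lim (u a @ \oo).
have uT a : l2 a -> forall e, 0 < e -> \forall n \near \oo, `|T a - u a n| <= e.
  by move=> /cu ca e e0; have /cvgrPdist_le := ca; apply.
exists T; split=> [a la|b x y lx ly|].
- apply: (@closed_cvg nat X \oo _ (u a) S cS) (cu a la).
  by apply: nearW => n; exact: Su.
- rewrite /T (_ : u (fun n => b * x n + y n) = fun n => b *: u x n + u y n); last first.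
    apply/funext => n; rewrite /u /series /= scaler_sumr -big_split.
    by apply: eq_bigr => i _; rewrite scalerDl scalerA.
  by apply: cvg_lim => //; apply: cvgD (cvgZl_tmp (cu x lx)) (cu y ly).
exists 8^-1, 3; split=> // a la; rewrite l2normE//; have va := (l2_vanishing a).1 la.
split.
  rewrite ler_pdivrMl//; apply: cnorm_le => s /clique_full us.
  apply/ler_addgt0Pr => e e0.
  have [N _ hN] := uT a la _ (divr_gt0 e0 (ltr0n R 8)).
  pose M := maxn N (\max_(i <- s) i.+1).
  have := hN M (leq_maxl _ _) => /= h1.
  have := (bnd a 0%N M).1; rewrite -/(series _ _) -/(u a M) => h2.
  have h3 : `|u a M| <= `|T a| + `|T a - u a M|.
    rewrite -{1}(subrK (T a) (u a M)) addrC; apply: le_trans (ler_normD _ _) _.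
    by rewrite distrC.
  have h4 : euc a s <= euc a (index_iota 0 M).
    apply: ler_sqrt_sqr; first exact: euc_ge0.
    rewrite !sqr_euc; apply: ler_sum_subset => // [i|i is_]; first exact: sqr_ge0.
    rewrite mem_index_iota /=; apply: leq_trans (leq_maxr _ _).
    exact: ltn_bigmax.
  by lra.
apply/ler_addgt0Pr => e e0; have [N _ hN] := uT a la e e0.
have := hN N (leqnn N) => /= h1.
have := (bnd a 0%N N).2; rewrite -/(series _ _) -/(u a N) => h2.
have h3 : `|T a| <= `|u a N| + `|T a - u a N|.
  rewrite -{1}(subrK (u a N) (T a)) addrC; exact: ler_normD.
have h4 : euc a (index_iota 0 N) <= cnorm full a.
  by apply: euc_le_cnorm => //; apply/clique_full; exact: iota_uniq.
by lra.
Qed.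

End L2Embedding.

(** * Estimates for almost disjoint blocks *)

Section AlmostDisjointBlocks.
Context {R : realType} {I : choiceType} (E : I -> I -> Prop).
Hypothesis symE : forall i j, E i j -> E j i.
Variables (z : nat -> cliqueSpace R E) (C : nat -> set I) (A : nat -> seq I).
Hypotheses (C_mono : forall n m, (n <= m)%N -> C n `<=` C m)
  (supp_z : forall n i, z n i <> 0 -> C n.+1 i)
  (A_C : forall n i, i \in A n -> C n.+1 i /\ ~ C n i)
  (A_clique : forall n, clique E (A n))
  (A_large : forall n, 4^-1 <= euc (z n) (A n))
  (A_join : forall n m i j, (n < m)%N -> i \in A n -> j \in A m -> E i j)
  (z_le2 : forall n, `|z n| <= 2)
  (z_small : forall n, cnorm E (restr (C n) (z n)) <= 16^-1 * 2^-1 ^+ n).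

(** The [w n] have disjoint supports, because [z n] lives on [C n.+1]; this gives the upper
    estimate. *)
Let w n : I -> R := restr (~` C n) (z n).
(** The [v n] have supports completely joined to each other; this gives the lower estimate. *)
Let v n : I -> R := restr [set` A n] (z n).

Let vw n : vanishing E (w n).
Proof. exact: vanishing_restr (cfunP (z n)). Qed.

Let vv n : vanishing E (v n).
Proof. exact: vanishing_restr (cfunP (z n)). Qed.

Lemma vanishing_sum (h : nat -> I -> R) (a : nat -> R) N M :
  (forall n, vanishing E (h n)) ->
  vanishing E (\sum_(N <= n < M) a n *: h n).
Proof.
move=> vh; elim/big_ind: _ => [|f g|n _]; [exact: vanishing0|exact: vanishingD|].
exact: vanishingZ.
Qed.

Lemma sum_neq0 (h : nat -> I -> R) (a : nat -> R) N M i :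
  (\sum_(N <= n < M) a n *: h n) i <> 0 ->
  exists2 n, (N <= n < M)%N & h n i <> 0.
Proof.
move=> hi; apply: contrapT => no; apply: hi; rewrite fct_sumE big_nat big1// => n Nn.
rewrite fctE (_ : h n i = 0) ?scaler0//; apply: contrapT => hn; apply: no.
by exists n.
Qed.

Lemma sqr_euc_recr (a : nat -> R) N M : (N <= M)%N ->
  euc a (index_iota N M.+1) ^+ 2 = euc a (index_iota N M) ^+ 2 + a M ^+ 2.
Proof. by move=> NM; rewrite !sqr_euc big_nat_recr. Qed.

Lemma w_upper (a : nat -> R) N M :
  cnorm E (\sum_(N <= n < M) a n *: w n) <= 2 * euc a (index_iota N M).
Proof.
apply: ler_sqrt_sqr; first by rewrite mulr_ge0// euc_ge0.
rewrite exprMn; have [MN|] := leqP M N.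
  rewrite big_geq// cnorm0.
  by rewrite expr0n /= mulr_ge0// sqr_ge0.
elim: M => // M IH; rewrite ltnS => NM; rewrite big_nat_recr// sqr_euc_recr//=.
have wM : cnorm E (a M *: w M) ^+ 2 <= 2 ^+ 2 * a M ^+ 2.
  rewrite cnormZ// exprMn real_normK ?num_real// mulrC ler_wpM2r ?sqr_ge0//.
  apply: ler_sqr_nneg; first exact: cnorm_ge0.
  apply: le_trans (z_le2 M); exact: cnorm_restr (cfunP (z M)).
apply: le_trans (cnorm_disjoint (vanishing_sum _ _ _ vw) (vanishingZ _ (vw M)) _) _.
  move=> i; apply: contrapT => /not_orP[/sum_neq0[n /andP[_ nM] wni] wMi].
  apply: wMi; rewrite fctE /w restrF ?scaler0// => nC; apply: nC.
  apply: (C_mono nM); apply: supp_z => zni; apply: wni.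
  by rewrite /w /restr zni; case: ifP.
rewrite mulrDr; apply: lerD => //; move: NM; rewrite leq_eqVlt => /orP[/eqP->|/IH//].
by rewrite big_geq// cnorm0 expr0n /= mulr_ge0 ?sqr_ge0.
Qed.

Lemma v_lower (a : nat -> R) N M :
  4^-1 * euc a (index_iota N M) <= cnorm E (\sum_(N <= n < M) a n *: v n).
Proof.
have v0 := cnorm_ge0 (vanishing_sum a N M vv).
apply: ler_sqrt_sqr => //; rewrite exprMn; have [MN|] := leqP M N.
  by rewrite [index_iota _ _](_ : _ = [::]) ?euc_nil ?expr0n /= ?mulr0 ?sqr_ge0//
    /index_iota (eqP MN).
elim: M {v0} => // M IH; rewrite ltnS => NM; rewrite big_nat_recr// sqr_euc_recr//=.
have vM : 4^-1 ^+ 2 * a M ^+ 2 <= cnorm E (a M *: v M) ^+ 2.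
  rewrite cnormZ// exprMn real_normK ?num_real// mulrC ler_wpM2l ?sqr_ge0//.
  apply: ler_sqr_nneg; first by rewrite invr_ge0.
  apply: le_trans (A_large M) _; apply: le_trans (euc_le_cnorm (vv M) (A_clique M)).
  rewrite (@eq_euc _ _ (z M) (v M))// => i iA.
  by rewrite /v restrT.
apply: le_trans (cnorm_full (vanishing_sum _ _ _ vv) (vanishingZ _ (vv M)) symE _).
  rewrite mulrDr; apply: lerD => //; move: NM; rewrite leq_eqVlt => /orP[/eqP->|/IH//].
  by rewrite [index_iota _ _](_ : _ = [::]) ?euc_nil ?expr0n /= ?mulr0 ?sqr_ge0//
    /index_iota subnn.
move=> i j /sum_neq0[n /andP[_ nM] vni] vMj.
have inA : i \in A n by apply: contrapT => iA; apply: vni; rewrite /v restrF.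
have jMA : j \in A M.
  by apply: contrapT => jA; apply: vMj; rewrite fctE /v restrF ?scaler0.
split; last exact: A_join nM inA jMA.
move=> ij; have [Ci _] := A_C inA; have [_] := A_C jMA; apply; rewrite -ij.
exact: C_mono nM _ Ci.
Qed.

(** [A m] lies in [C m.+1] minus [C m], where among the [w n] only [w m] can be nonzero. Hence the
    lower bound for the [v n] transfers to the [w n]. *)
Lemma v_restr_w (a : nat -> R) N M :
  \sum_(N <= n < M) a n *: v n =
  restr (\bigcup_n [set` A n]) (\sum_(N <= n < M) a n *: w n).
Proof.
apply/funext => i; have [[m _ /= im]|nA] := pselect ((\bigcup_n [set` A n]) i).
  rewrite restrT; last by exists m.
  rewrite !fct_sumE; apply: eq_bigr => n _; rewrite !fctE; congr (_ * _).
  have [Cm nC] := A_C im.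
  have [nm|mn|nm] := ltngtP n m.
  - have zn : z n i = 0.
      by apply: contrapT => /supp_z Ci; apply: nC; exact: C_mono nm _ Ci.
    by rewrite /v /w /restr zn; do 2 case: ifP.
  - rewrite /w restrF; last by move=> nCn; apply: nCn; exact: C_mono mn _ Cm.
    rewrite /v restrF// => /= iA; have [_] := A_C iA; apply.
    exact: C_mono mn _ Cm.
  - by rewrite nm /v /w !restrT.
rewrite restrF// fct_sumE big1// => n _; rewrite fctE /v restrF ?scaler0//.
by move=> iA; apply: nA; exists n.
Qed.

(** Each [a n] is at most the Euclidean norm, and the geometric series sums to at most [2 / 16]. *)
Lemma small_part (a : nat -> R) N M :
  cnorm E (\sum_(N <= n < M) a n *: restr (C n) (z n)) <= 8^-1 * euc a (index_iota N M).
Proof.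
have vC n : vanishing E (restr (C n) (z n)) by exact: vanishing_restr (cfunP (z n)).
set q := euc _ _; have q0 : 0 <= q by exact: euc_ge0.
apply: le_trans (_ : \sum_(N <= n < M) q * (16^-1 * 2^-1 ^+ n) <= _).
  rewrite big_nat [leRHS]big_nat.
  suff : vanishing E (\sum_(N <= n < M | (N <= n < M)%N) a n *: restr (C n) (z n)) /\
      cnorm E (\sum_(N <= n < M | (N <= n < M)%N) a n *: restr (C n) (z n)) <=
      \sum_(N <= n < M | (N <= n < M)%N) q * (16^-1 * 2^-1 ^+ n) by case.
  elim/big_ind2: _ => [|f x g y [vf fx] [vg gy]|n nNM].
  - split; first exact: vanishing0.
    by rewrite cnorm0.
  - split; first exact: vanishingD.
    by apply: le_trans (cnormD vf vg) _; exact: lerD.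
  - split; first exact: vanishingZ.
    rewrite cnormZ//; apply: ler_pM => //; first exact: cnorm_ge0.
    by apply: euc_ge_norm; rewrite mem_index_iota.
rewrite -mulr_sumr mulrC ler_wpM2r// -mulr_sumr.
suff : \sum_(N <= n < M) 2^-1 ^+ n <= (2 : R) by lra.
apply: le_trans (_ : \sum_(0 <= n < M) 2^-1 ^+ n <= _).
  have p n : 0 <= (2^-1 : R) ^+ n by rewrite exprn_ge0// invr_ge0.
  have [MN|NM] := leqP M N; first by rewrite big_geq// sumr_ge0.
  by rewrite (@big_cat_nat _ _ _ N 0 M)//= ?lerDr ?sumr_ge0// ltnW.
suff -> : \sum_(0 <= n < M) (2^-1 : R) ^+ n = 2 - 2 * 2^-1 ^+ M.
  by rewrite lerBlDr lerDl mulr_ge0// exprn_ge0// invr_ge0.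
elim: M {q q0} => [|M IH]; first by rewrite big_geq// expr0; ring.
by rewrite big_nat_recr//= IH exprS; field.
Qed.

(** The constants: [1/4 - 1/8 = 1/8] from below, and [2 + 1/8 <= 3] from above. *)
Lemma almost_disjoint_blocks (a : nat -> R) N M :
  euc a (index_iota N M) <= 8 * `|\sum_(N <= n < M) a n *: z n| /\
  `|\sum_(N <= n < M) a n *: z n| <= 3 * euc a (index_iota N M).
Proof.
have split_z : (\sum_(N <= n < M) a n *: z n : cliqueSpace R E) =
    \sum_(N <= n < M) a n *: w n + \sum_(N <= n < M) a n *: restr (C n) (z n)
    :> (I -> R).
  rewrite -big_split /=.
  elim/big_ind2: _ => // [x f y g <- <-//|n _].
  by rewrite -scalerDr addrC -restrC.
have vC n : vanishing E (restr (C n) (z n)) by exact: vanishing_restr (cfunP (z n)).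
have vW := vanishing_sum a N M vw; have vS := vanishing_sum a N M vC.
have := w_upper a N M; have := v_lower a N M; rewrite v_restr_w.
have := cnorm_restr (\bigcup_n [set` A n]) vW; have := small_part a N M.
have := cnormD vW vS; have := cnormB (vanishingD vW vS) vS; rewrite addrK.
have := euc_ge0 a (index_iota N M).
rewrite normE split_z; lra.
Qed.

End AlmostDisjointBlocks.

(** * Inductive choice in a nonseparable subspace *)

Section NonseparableSubspaces.
Context {R : realType} {I : choiceType} (E : I -> I -> Prop).
Hypotheses (symE : forall i j, E i j -> E j i) (gE : generic E).
Local Notation X := (cliqueSpace R E).
Variable S : set X.
Hypothesis subS : closed_subspace S.

Let S0 : S 0. Proof. by case: subS => -[]. Qed.

Let SZD a x y : S x -> S y -> S (a *: x + y).
Proof. by case: subS => -[_ h] _; exact: h. Qed.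

Let SB x y : S x -> S y -> S (x - y).
Proof. by move=> Sx Sy; rewrite addrC -scaleN1r; exact: SZD. Qed.

(** For each precision, restrictions to [C] fall into countably many labels; one representative in
    [S] per label gives a dense set, since distances in [S] are controlled on [C]. *)
Lemma separable_of_restriction (C : set I) : countable C ->
  (forall y, S y -> `|y| <= 2 * cnorm E (restr C y)) -> separable_set S.
Proof.
move=> cC bdd.
have e0 n : (0 : R) < n.+1%:R^-1 by rewrite invr_gt0.
have [lab labP] := choice (fun n => separating_label E cC (e0 n)).
have /choice[d dP] (p : nat * nat) : exists x : X, S x /\
    forall y : X, S y -> lab p.1 y = p.2 -> lab p.1 x = p.2.
  have [[x Sx lx]|no] := pselect (exists2 x : X, S x & lab p.1 x = p.2).
    by exists x; split.
  by exists 0; split=> // y Sy ly; case: no; exists y.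
exists (range d); first exact: sub_countable (card_image_le _ _) (countableP _).
split=> [_ [p _ <-]|y Sy U /nbhs_ballP[e /= ep eU]]; first by case: (dP p).
have [n] := ltr_add_invr (divr_gt0 ep (ltr0n R 2)); rewrite add0r => ne.
pose x := d (n, lab n y); have [Sx lx] := dP (n, lab n y).
exists x; split; first by exists (n, lab n y).
apply: eU; rewrite -ball_normE /ball_ /=.
apply: le_lt_trans (bdd _ (SB Sy Sx)) _; rewrite cfunB.
have /le_lt_trans/(_ ne) := labP n y x (cfunP y) (cfunP x) (esym (lx y Sy erefl)).
by rewrite -/x; move: (cnorm _ _) => q; lra.
Qed.

Hypothesis nsS : ~ separable_set S.

(** Some vector of [S] has less than half of its norm on [C]; normalized, it has more than [1/2]
    outside, and a clique there reaches [1/4]. *)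
Lemma escaping_vector (C : set I) : countable C -> exists (x : X) (A : seq I),
  [/\ S x, `|x| = 1, clique E A, {in A, forall i, ~ C i} & 4^-1 <= euc x A].
Proof.
move=> cC.
have [y Sy ylt] : exists2 y, S y & 2 * cnorm E (restr C y) < `|y|.
  apply: contrapT => no; apply: nsS; apply: (separable_of_restriction cC) => y Sy.
  by rewrite leNgt; apply/negP => h; apply: no; exists y.
have vC (x : X) D : vanishing E (restr D x) by exact: vanishing_restr (cfunP x).
have y0 : 0 < `|y| by apply: le_lt_trans ylt; rewrite mulr_ge0// cnorm_ge0.
pose x := `|y|^-1 *: y.
have x1 : `|x| = 1 by rewrite normrZ ger0_norm ?invr_ge0// mulVf ?gt_eqF.
have xC : cnorm E (restr C x) < 2^-1.
  have -> : restr C x = `|y|^-1 *: restr C y by rewrite -restrZ.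
  rewrite cnormZ// ger0_norm ?invr_ge0// ltr_pdivrMl//.
  by lra.
have xnC : 2^-1 < cnorm E (restr (~` C) x).
  have := cnormD (vC x C) (vC x (~` C)); rewrite -restrC -normE x1; lra.
have [A0 cA0 hA0] : exists2 A0, clique E A0 & 4^-1 <= euc (restr (~` C) x) A0.
  apply: contrapT => no; suff : cnorm E (restr (~` C) x) <= 4^-1 by lra.
  apply: cnorm_le => s cs; rewrite leNgt; apply/negP => h; apply: no.
  by exists s => //; exact: ltW.
exists x, [seq i <- A0 | `[< (~` C) i >]]; split=> //.
- by rewrite /x -[_ *: _]addr0; exact: SZD.
- exact: clique_filter.
- by move=> i; rewrite mem_filter => /andP[/asboolP].
- by rewrite -euc_restr.
Qed.

Let pts : set (X * seq I) :=
  [set p | [/\ S p.1, `|p.1| = 1, clique E p.2 & 4^-1 <= euc p.1 p.2]].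

(** [generic] wants duplicate-free lists for every index; on [pts], where the list is a clique,
    [undup] changes nothing. *)
Let blk (p : X * seq I) : seq I := undup p.2.

Let pts_spread : spread blk pts.
Proof.
apply: uncountable_spread.
  move=> [x A] [/= _ _ [uA _] hA]; rewrite /blk /= undup_id//.
  by apply: contraTneq hA => ->; rewrite euc_nil -ltNge invr_gt0.
move=> C /escaping_vector[x [A [Sx x1 cA AC hA]]].
by exists (x, A); split=> // i; rewrite mem_undup; exact: AC.
Qed.

(** One step of the induction: the reservoir [G] shrinks to the pairs whose cliques are completely
    joined to [A], and [C] grows to absorb the support of [z] and [A]. *)
Let good (G : set (X * seq I)) (C : set I) (e : R) (z : X) (A : seq I)
    (G' : set (X * seq I)) (C' : set I) : Prop :=
  [/\ [/\ G' `<=` G, spread blk G', countable C' & C `<=` C'],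
      [/\ forall i, z i <> 0 -> C' i, {in A, forall i, C' i /\ ~ C i},
          exists2 p, G p & A = blk p &
          forall p i j, G' p -> i \in A -> j \in blk p -> E i j],
      [/\ S z, `|z| <= 2 & cnorm E (restr C z) <= e]
    & clique E A /\ 4^-1 <= euc z A].

Let good_step (G : set (X * seq I)) (C : set I) (e : R) :
  G `<=` pts -> spread blk G -> countable C -> 0 < e ->
  exists z A G' C', good G C e z A G' C'.
Proof.
move=> Gp sG cC e0; have [lab labP] := separating_label E cC e0.
have [n sG1] := spread_pigeonhole (fun p => lab (p.1 : X)) sG.
have [[y Ay] [Gy /= ly]] := spread_nonempty sG1.
pose supp (x : X) := [set i | x i <> 0].
have csupp x : countable (supp x) by exact: vanishing_countable (cfunP x).
(* The vector will be [z = x - y]: equal labels make it small on [C], and taking the clique of [x]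
   off the support of [y] leaves the values on [A] unchanged. *)
have sG2 := spread_avoiding (countableU cC (csupp y)) sG1.
have [[x A] [[Gx /= lx] xA] sG3] := gE (fun=> undup_uniq _) sG2 true.
have [/= Sy y1 _ _] := Gp _ Gy; have [/= Sx x1 cA hA] := Gp _ Gx.
have uA : undup A = A by apply: undup_id; case: cA.
rewrite /avoiding /= /blk /= uA in xA sG3.
move: sG3; set G3 := (X in spread _ X) => sG3.
exists (x - y), A, G3, ((C `|` supp y) `|` (supp x `|` [set` A])).
split.
- split=> //; first by move=> p [[[]]].
    by apply: countableU; apply: countableU => //; exact: finite_set_countable.
  by move=> i Ci; left; left.
- split.
  + move=> i xyi; have [xi|xi] := pselect (x i = 0); last by right; left.
    left; right => yi; apply: xyi.
    by rewrite evalB xi yi subr0.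
  + by move=> i iA; split; [right; right|move=> Ci; apply: (xA i iA); left].
  + by exists (x, A) => //; rewrite /blk /= uA.
  + by move=> p i j [_ h] iA jp; case: (h i j iA jp) => _ [_]; exact.
- split; first exact: SB.
    apply: le_trans (ler_normB _ _) _; rewrite x1 y1; lra.
  by rewrite cfunB; apply: labP; rewrite ?ly//; exact: cfunP.
- split=> //; rewrite (@eq_euc _ _ _ x)// => i iA; rewrite evalB.
  have -> : y i = 0; last by rewrite subr0.
  by apply: contrapT => yi; apply: (xA i iA); right.
Qed.

Lemma nonseparable_contains_l2 : contains_l2 S.
Proof.
pose state : Type := (set (X * seq I) * set I)%type.
pose inv (st : state) := [/\ st.1 `<=` pts, spread blk st.1 & countable st.2].
pose eps n : R := 16^-1 * 2^-1 ^+ n.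
have eps0 n : 0 < eps n by rewrite mulr_gt0 ?exprn_gt0 ?invr_gt0.
have /choice[next nextP] (p : nat * state) : exists o : X * seq I * state,
    inv p.2 -> good p.2.1 p.2.2 (eps p.1) o.1.1 o.1.2 o.2.1 o.2.2.
  have [[h1 h2 h3]|no] := pselect (inv p.2); last first.
    by exists (0, [::], (set0, set0)) => /no.
  have [z [A [G' [C' h]]]] := good_step h1 h2 h3 (eps0 p.1).
  by exists (z, A, (G', C')).
pose st := fix st n : state := if n is m.+1 then (next (m, st m)).2 else (pts, set0).
pose z n := (next (n, st n)).1.1; pose A n := (next (n, st n)).1.2.
have invP n : inv (st n).
  elim: n => [|n IH] /=; first by split=> //; exact: countable0.
  have [[h1 h2 h3 _] _ _ _] := nextP (n, st n) IH; split=> //.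
  by case: IH => + _ _; exact: subset_trans.
have goodP n : good (st n).1 (st n).2 (eps n) (z n) (A n) (st n.+1).1 (st n.+1).2.
  exact: (nextP (n, st n) (invP n)).
have mono n m : (n <= m)%N -> (st n).2 `<=` (st m).2 /\ (st m).1 `<=` (st n).1.
  elim: m => [|m IH]; first by rewrite leqn0 => /eqP->; split.
  rewrite leq_eqVlt => /orP[/eqP->|/IH[h1 h2]]; first by split.
  have [[g1 _ _ g2] _ _ _] := goodP m.
  by split; [exact: subset_trans g2|exact: subset_trans h2].
apply: (l2_embedding (z := z) subS) => [n|a N M].
  by have [_ _ []] := goodP n.
apply: (almost_disjoint_blocks symE (C := fun n => (st n).2) (A := A)).
- by move=> n m /mono[].
- by move=> n i; have [_ [h _ _ _] _ _] := goodP n; exact: h.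
- by move=> n i; have [_ [_ h _ _] _ _] := goodP n; exact: h.
- by move=> n; have [_ _ _ []] := goodP n.
- by move=> n; have [_ _ _ []] := goodP n.
- move=> n m i j nm iA jA; have [_ [_ _ _ h] _ _] := goodP n.
  (* [A m] comes from a pair of the reservoir at [m], contained in the one at [n.+1], whose cliques
     are all joined to [A n]. *)
  have [_ [_ _ [p Gp Ap] _] _ _] := goodP m.
  by apply: (h p) => //; [exact: (mono _ _ nm).2|rewrite -Ap].
- by move=> n; have [_ _ []] := goodP n.
- by move=> n; have [_ _ []] := goodP n.
Qed.

End NonseparableSubspaces.

Lemma omega1_order_subtype (T : choiceType) (A : set T) (lt : T -> T -> Prop) :
  omega1_order A lt -> omega1_order [set: A] (fun x y => lt (val x) (val y)).
Proof.
have vA (x : A) : A (val x) by exact: set_mem (valP x).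
move=> [cA [irr trans] tot minA seg]; split.
- move=> cT; apply: cA; apply: (@sub_countable _ _ _ (range (val : A -> T))).
    apply: subset_card_le => x Ax.
    by exists (Sub x (mem_set Ax)) => //; rewrite SubK.
  exact: sub_countable (card_image_le _ _) cT.
- split=> [x _|x y z _ _ _]; first exact: irr.
  exact: trans.
- move=> x y _ _; have [|/val_inj|] := tot (val x) (val y) (vA x) (vA y).
  + by constructor 1.
  + by constructor 2.
  + by constructor 3.
- move=> B _ [b Bb].
  have [||_ [m Bm <-] h] := minA ((val : A -> T) @` B).
  + by move=> _ [x _ <-].
  + by exists (val b), b.
  + by exists m => // x Bx; apply: h; exists x.
- move=> x _; have /countable_injP[u uinj] := seg (val x) (vA x).
  apply/countable_injP; exists (u \o val) => y z; rewrite !inE => -[_ yx] [_ zx] /= e.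
  by apply: val_inj; apply: uinj; rewrite ?inE.
Qed.

Theorem theorem1p2 (R : realType) :
  (exists A : set R, ~ meager A /\ card_omega1 A) ->
  (* (1) *)
  (forall (I : choiceType) (lt : I -> I -> Prop), omega1_order [set: I] lt ->
     exists N : (I -> R) -> R,
       equivalent_l2_norm N /\
       ~ (exists Y : set (I -> R), [/\ Y `<=` @l2 R I, ~ countable Y &
            exists2 delta : R, 0 < delta &
              forall y y', Y y -> Y y' -> y <> y' ->
                N (fun i => y i - y' i) = delta])) /\
  (* (2) *)
  (exists X : completeNormedModType R,
     [/\ hilbert_generated X,
         ~ separable_space X,
         (forall S : set X, closed_subspace S -> ~ separable_set S -> contains_l2 S),
         ~ (exists Y : set X, [/\ Y `<=` @unit_sphere R X, ~ countable Y & equilateral Y])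
       & forall eps : R, 0 < eps ->
           ~ (exists Y : set X, [/\ Y `<=` @unit_sphere R X, ~ countable Y &
                delta_separated (1 + eps) Y])]).
Proof.
move=> [A [mA oA]]; split=> [I lt wI|].
  have [E symE gE] := generic_graph wI mA oA.
  exists (renorm E); split; first exact: renorm_equivalent.
  by move=> [Y [lY cY [d d0 eqY]]]; exact: (renorm_no_equilateral symE gE d0 lY cY eqY).
(* For the second part the elements of the nonmeager set itself serve as vertices. *)
have [lt wA] := oA; have wI := omega1_order_subtype wA.
have [E symE gE] := generic_graph wI mA oA.
exists (cliqueSpace R E); split.
- exact: clique_space_hilbert_generated.
- by apply: clique_space_nonseparable; case: wI.
- move=> S cS nS; exact: (nonseparable_contains_l2 symE gE cS nS).
- by move=> [Y [_ cY]]; exact: no_uncountable_equilateral symE gE Y cY.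
- move=> eps eps0 [Y [Y1 cY]]; exact: no_uncountable_separated gE eps Y eps0 Y1 cY.
Qed.
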